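(* Let $k$ be an algebraically closed field of characteristic $p\ge 0$ and let $I$ be a $\Delta$-cellular binomial ideal in $k[x]=k[x_1,\dots,x_n]$. Let $(L_\rho,\rho)$ be the partial character on $\mathbb Z^\Delta$ such that $I\cap k[\mathbb N^\Delta]=I(\rho)$. Let $g$, $\rho_1,\dots,\rho_g$ and $\chi_1,\dots,\chi_g$ be attached to $\rho$ as in the context, so that $I(\rho_\ell)$ is the $I(\chi_\ell)$-primary component of $I(\rho)$ for $\ell=1,\dots,g$. The minimal associated primes of $I$ are $$P_\ell=k[x]\cdot I(\chi_\ell)+\langle x_i: i\in\Delta^c\rangle,\qquad \ell=1,\dots,g.$$ For $\ell=1,\dots,g$, the $P_\ell$-primary component of $I$ is $$\Big((I+I(\rho_\ell)):\big(\textstyle\prod_{i\in\Delta}x_i\big)^\infty\Big)+M_{\rm emb}(I).$$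
   Context: Conventions: $0\in\mathbb N$; $k^*$ is the multiplicative group of $k$. A binomial is a polynomial with at most two terms; a binomial ideal is an ideal generated by binomials. For $\Delta\subseteq\{1,\dots,n\}$, $\Delta^c$ is its complement, $\mathbb N^\Delta=\{u\in\mathbb N^n: u_i=0 \text{ for } i\notin\Delta\}$, $\mathbb Z^\Delta$ is defined analogously, and $k[\mathbb N^\Delta]=k[x_i: i\in\Delta]$. A partial character on $\mathbb Z^\Delta$ is a pair $(L_\rho,\rho)$ with $L_\rho$ a subgroup of $\mathbb Z^\Delta$ and $\rho:L_\rho\to k^*$ a group homomorphism. Its lattice ideal is $I(\rho)=\langle x^u-\rho(u-v)x^v: u,v\in\mathbb N^\Delta,\ u-v\in L_\rho\rangle\subseteq k[\mathbb N^\Delta]$; its extension to $k[x]$ is also denoted $I(\rho)$. The saturation of a lattice $L\subseteq\mathbb Z^\Delta$ is $\operatorname{Sat}(L)=(\mathbb Q\otimes_{\mathbb Z}L)\cap\mathbb Z^\Delta$. A proper ideal $I\subset k[x]$ is $\Delta$-cellular if $x_i$ is a nonzerodivisor modulo $I$ for $i\in\Delta$ and nilpotent modulo $I$ for $i\in\Delta^c$. If $I$ is a $\Delta$-cellular binomial ideal, there is a (unique) partial character $(L_\rho,\rho)$ on $\mathbb Z^\Delta$ with $I\cap k[\mathbb N^\Delta]=I(\rho)$. A lattice $L\subseteq\mathbb Z^\Delta$ is associated to a $\Delta$-cellular binomial ideal $I$ if there is a monomial $m\in k[\mathbb N^{\Delta^c}]$ (a witness monomial of $L$) such that $(I:m)\cap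 k[\mathbb N^\Delta]=I(\tau)$ for some partial character $\tau:L\to k^*$. With $I\cap k[\mathbb N^\Delta]=I(\rho)$, an associated lattice $L$ is embedded if $\operatorname{rank}(L)>\operatorname{rank}(L_\rho)$. $M_{\rm emb}(I)\subseteq k[x]$ is the monomial ideal generated by the witness monomials of embedded associated lattices to $I$ (it is $0$ if there are none). Decomposition of lattice ideals (known): let $(L_\rho,\rho)$ be a partial character on $\mathbb Z^\Delta$. If $p>0$, let $\operatorname{Sat}'_p(L_\rho)$ be the largest sublattice of $\operatorname{Sat}(L_\rho)$ containing $L_\rho$ such that $|\operatorname{Sat}'_p(L_\rho)/L_\rho|$ is coprime to $p$; let $\operatorname{Sat}'_0(L_\rho)=\operatorname{Sat}(L_\rho)$. Put $g=|\operatorname{Sat}'_p(L_\rho)/L_\rho|$. There are exactly $g$ distinct partial characters $\rho_1,\dots,\rho_g$ extending $\rho$ to $\operatorname{Sat}'_p(L_\rho)$, and each $\rho_\ell$ extends uniquely to a partial character $\chi_\ell$ on $\operatorname{Sat}(L_\rho)$. The associated primes of $I(\rho)$ are $I(\chi_1),\dots,I(\chi_g)$, all minimal, $I(\rho_\ell)$ is $I(\chi_\ell)$-primary, and $I(\rho)=\bigcap_{\ell=1}^g I(\rho_\ell)$ is the minimal primary decomposition. *)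

(* Defs.v *)
From HB Require Import structures.
From mathcomp Require Import all_boot all_order all_algebra.
From mathcomp Require Import boolp classical_sets mpoly.

Set Implicit Arguments.
Unset Strict Implicit.
Unset Printing Implicit Defensive.

Import GRing.Theory.
Local Open Scope classical_set_scope.
Local Open Scope ring_scope.

Definition has_char (k : fieldType) (p : nat) : Prop :=
  if p is 0%N then [pchar k] =i pred0 else p \in [pchar k].

(** Ideals are Prop-valued sets; [idealr_closed] is the library's notion of a
    *proper* ideal. *)

Section Ideals.
Variable R : comNzRingType.
Implicit Types (I J P Q S : set R) (f : R).

(* The ideal of the subring [A] generated by [S]. *)
Definition gen_over (A S : set R) : set R :=
  [set f | exists (r : nat) (c s : 'I_r -> R),
    [/\ forall i, A (c i), forall i, S (s i) & f = \sum_i c i * s i]].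

Definition ideal_gen S : set R := gen_over setT S.

Definition ideal_add I J : set R := [set f + g | f in I & g in J].

Definition colon I f : set R := [set g | I (g * f)].

Definition colon_infty I f : set R := [set g | exists N : nat, I (g * f ^+ N)].

Definition radical I : set R := [set f | exists N : nat, I (f ^+ N)].

Definition prime_ideal P : Prop :=
  idealr_closed (mem P) /\ prime_idealr_closed (mem P).

Definition primary_ideal Q : Prop :=
  idealr_closed (mem Q) /\ forall f g, Q (f * g) -> Q f \/ radical Q g.

Definition associated_prime I P : Prop :=
  prime_ideal P /\ exists f, P = colon I f.

Definition minimal_associated_prime I P : Prop :=
  associated_prime I P /\
  forall P', associated_prime I P' -> P' `<=` P -> P' = P.

Definition minimal_primary_decomposition I (r : nat) (Q : 'I_r -> set R) :
    Prop :=
  [/\ forall j, primary_ideal (Q j),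
      I = \bigcap_j Q j,
      injective (fun j => radical (Q j)) &
      forall j, ~ \bigcap_(i in [set i | i != j]) Q i `<=` Q j].

(* The uniqueness clause makes this meaningful when [P] is a minimal associated
   prime of [I]; embedded components need not be unique. *)
Definition is_primary_component I P J : Prop :=
  (exists (r : nat) (Q : 'I_r -> set R), minimal_primary_decomposition I Q) /\
  (forall (r : nat) (Q : 'I_r -> set R), minimal_primary_decomposition I Q ->
     exists j, radical (Q j) = P /\ Q j = J).

End Ideals.

(** Sublattices of Z^Delta inside Z^n = ['rV[int]_n]. *)

Section Lattices.
Variables (n : nat) (Delta : {set 'I_n}).
Implicit Types (L S T : set 'rV[int]_n).

Definition Zpow : set 'rV[int]_n := [set v | forall i, i \notin Delta -> v 0 i = 0].

Definition lattice L : Prop := zmod_closed (mem L) /\ L `<=` Zpow.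

(* Elements of Z^Delta in the Q-span of finitely many elements of [L]. *)
Definition Sat L : set 'rV[int]_n :=
  [set v | Zpow v /\
    exists (r : nat) (M : 'M[int]_(r, n)), (forall i, L (row i M)) /\
      (map_mx intr v <= (map_mx intr M : 'M[rat]_(r, n)))%MS].

(* The largest number of Q-linearly independent elements of [L]. *)
Definition lattice_rank L : nat :=
  \max_(r < n.+1 | `[< exists M : 'M[int]_(r, n), (forall i, L (row i M)) /\
                         row_free (map_mx intr M : 'M[rat]_(r, n)) >]) r.

(* For L contained in S: a family of g coset representatives of S / L. *)
Definition lattice_index L S (g : nat) : Prop :=
  exists r : 'I_g -> 'rV[int]_n,
    (forall i, S (r i)) /\ (forall v, S v -> exists! i, L (v - r i)).

Definition prime_to_ext (p : nat) L T : Prop :=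
  [/\ lattice T, L `<=` T, T `<=` Sat L &
      exists g, lattice_index L T g /\ coprime g p].

Definition is_Sat' (p : nat) L S : Prop :=
  if p is 0%N then S = Sat L
  else prime_to_ext p L S /\ forall T, prime_to_ext p L T -> T `<=` S.

End Lattices.

(** A partial character is a lattice [L] with a function [rho] on all of Z^n of
    which only the values on [L] matter. *)

Section Binomials.
Variables (n : nat) (k : closedFieldType) (Delta : {set 'I_n}).
Implicit Types (I : set {mpoly k[n]}) (L : set 'rV[int]_n)
  (rho : 'rV[int]_n -> k).

Definition partial_character L rho : Prop :=
  [/\ lattice Delta L,
      forall u, L u -> rho u != 0 &
      forall u v, L u -> L v -> rho (u + v) = rho u * rho v].

Definition extends_to L rho L' rho' : Prop :=
  [/\ partial_character L' rho', L `<=` L' & forall u, L u -> rho' u = rho u].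

Definition Npow (D : {set 'I_n}) : set 'X_{1..n} :=
  [set u | forall i, i \notin D -> u i = 0%N].

Definition polysub : set {mpoly k[n]} :=
  [set f | forall u, u \in msupp f -> Npow Delta u].

Definition mnm_diff (u v : 'X_{1..n}) : 'rV[int]_n :=
  \row_i ((u i)%:Z - (v i)%:Z).

(* The lattice ideal in k[N^Delta]; [ideal_gen] of it is its extension to k[x]. *)
Definition lattice_ideal L rho : set {mpoly k[n]} :=
  gen_over polysub
    [set f | exists u v : 'X_{1..n},
      [/\ Npow Delta u, Npow Delta v, L (mnm_diff u v) &
          f = 'X_[u] - rho (mnm_diff u v) *: 'X_[v]]].

Definition binomial_ideal I : Prop :=
  exists B : set {mpoly k[n]},
    (forall f, B f -> (size (msupp f) <= 2)%N) /\ I = ideal_gen B.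

Definition cellular I : Prop :=
  [/\ idealr_closed (mem I),
      forall i, i \in Delta -> forall f, I ('X_i * f) -> I f &
      forall i, i \notin Delta -> exists N : nat, I ('X_i ^+ N)].

Definition has_character I L rho : Prop :=
  partial_character L rho /\ I `&` polysub = lattice_ideal L rho.

Definition witness_monomial I L (m : 'X_{1..n}) : Prop :=
  Npow (~: Delta) m /\ exists tau, has_character (colon I 'X_[m]) L tau.

Definition associated_lattice I L : Prop := exists m, witness_monomial I L m.

Definition embedded_lattice I L : Prop :=
  associated_lattice I L /\
  exists L0 rho0, has_character I L0 rho0 /\
    (lattice_rank L0 < lattice_rank L)%N.

Definition M_emb I : set {mpoly k[n]} :=
  ideal_gen [set f | exists L m,
    [/\ embedded_lattice I L, witness_monomial I L m & f = 'X_[m]]].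

End Binomials.

(* Main.v *)
(** A binomial ideal is governed by the congruence it induces on monomials: if
    [f] is in [I], each monomial of [f] lies in [I] or is congruent to a scalar
    multiple of another one.  For a cellular [I] every [I : x^a] with [x^a] not
    in [I] has a lattice [L_a] containing [L], and [x^a] is in [M_emb I] exactly
    when [L_a] is not contained in [Sat L].

    The component of [I] at the minimal prime [P_l] is
    [{f | s f in I for some s not in P_l}].  It contains the proposed ideal [J_l]:
    a generator [x^u - z x^v] of [I(rho_l)] is killed by the cofactor of
    [x^(gu) - z^g x^(gv)], which is not in [P_l] as [g] is invertible in [k],
    and [x^a] in [M_emb I] by a binomial [x^w - c x^w'] with [w - w'] outside
    [Sat L].  Conversely, modulo [P_l] any [s] outside [P_l] is a sum [h] of
    monomials over N^Delta that are pairwise distinct modulo [Sat L], and [P_l] is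
    contained in the radical of [J_l]; so it suffices that such an [h] is a
    nonzerodivisor modulo [J_l].  The congruence of [J_l] relates [x^(u+w)] and
    [x^(u+w')] only when [w - w'] is in [Sat L], hence each orbit of monomials
    is graded by Z^Delta / Sat L, and a product of two leading monomials cannot
    cancel.

    A prime [P] over [I] without monomials over N^Delta contains a binomial
    [x^u - z x^v] for each [u - v] in [Sat L], by factoring [X^N - c]; this
    gives a character of [Sat L] extending [rho], and by orthogonality of the
    characters of [S' / L] it is one of the [chi_l]. *)

Require Import Defs.
From HB Require Import structures.
From mathcomp Require Import all_boot all_order all_algebra.
From mathcomp Require Import boolp classical_sets mpoly.
From mathcomp Require Import ring lra zify.
Set Implicit Arguments.
Unset Strict Implicit.
Unset Printing Implicit Defensive.
Import Order.TTheory GRing.Theory Num.Theory.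
Local Open Scope classical_set_scope.
Local Open Scope ring_scope.

(** * Primary decomposition *)

Section CommutativeAlgebra.
Variable R : comNzRingType.
Implicit Types (I J P Q S : set R) (f g a : R).

(** Unlike [idealr_closed], this admits the unit ideal, which colons, sums and saturations can
    produce. *)
Definition is_ideal J : Prop := J 0 /\ forall a f g, J f -> J g -> J (a * f + g).

Lemma idealr_closedP J : idealr_closed (mem J) <-> is_ideal J /\ ~ J 1.
Proof.
split=> [[J0 J1 JD]|[[J0 JD] J1]].
  split; last by move=> H; move: J1; rewrite -[1 \notin _]/(~~ (1 \in J)) mem_set.
  split; first by move: J0; rewrite inE.
  by move=> a f g Jf Jg; have := JD a f g; rewrite !inE; apply.
split; first by rewrite inE.
  by apply/negP; rewrite inE.
by move=> a f g; rewrite !inE; apply: JD.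
Qed.

Section IdealTheory.
Variables (J : set R) (idJ : is_ideal J).

Lemma ideal0 : J 0. Proof. by case: idJ. Qed.

Lemma idealMl a f : J f -> J (a * f).
Proof. by move=> Jf; rewrite -[_ * _]addr0; case: idJ => J0; apply. Qed.

Lemma idealMr a f : J f -> J (f * a).
Proof. by rewrite mulrC; apply: idealMl. Qed.

Lemma idealD f g : J f -> J g -> J (f + g).
Proof. by move=> Jf Jg; rewrite -[f]mul1r; case: idJ => _; apply. Qed.

Lemma idealN f : J f -> J (- f).
Proof. by rewrite -mulN1r; apply: idealMl. Qed.

Lemma idealB f g : J f -> J g -> J (f - g).
Proof. by move=> Jf /idealN; apply: idealD. Qed.

Lemma idealBr f g : J (f - g) -> J g -> J f.
Proof. by move=> Jfg Jg; rewrite -(subrK g f); apply: idealD. Qed.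

Lemma idealBl f g : J (f - g) -> J f -> J g.
Proof. by move=> Jfg Jf; rewrite -(subKr f g); apply: idealB. Qed.

Lemma ideal_sum (T : Type) (s : seq T) (B : pred T) (F : T -> R) :
  (forall i, B i -> J (F i)) -> J (\sum_(i <- s | B i) F i).
Proof. by move=> JF; elim/big_ind: _ => //; [exact: ideal0 | exact: idealD]. Qed.

Lemma colon_ideal f : is_ideal (colon J f).
Proof.
split=> [|a g h]; rewrite /colon /=; first by rewrite mul0r; apply: ideal0.
by move=> Jg Jh; rewrite mulrDl -mulrA; apply: idealD => //; apply: idealMl.
Qed.

Lemma sub_colon f : J `<=` colon J f.
Proof. by move=> g Jg; apply: idealMr. Qed.

Lemma radical_ideal : is_ideal (radical J).
Proof.
split=> [|a f g [M JM] [N JN]]; first by exists 1%N; rewrite expr1; apply: ideal0.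
exists (M + N)%N; rewrite exprDn; apply: ideal_sum => i _.
rewrite -mulr_natl; apply: idealMl.
case: (leqP N i) => leNi; first by rewrite -(subnK leNi) exprD mulrA; apply: idealMl.
rewrite mulrC; apply: idealMl.
have leM : (M <= M + N - i)%N by lia.
rewrite -(subnK leM) exprD. rewrite (exprMn M) mulrA; exact: idealMl.
Qed.

Lemma sub_radical : J `<=` radical J.
Proof. by move=> f Jf; exists 1%N; rewrite expr1. Qed.

Lemma radical1 : ~ J 1 -> ~ radical J 1.
Proof. by move=> J1 [N]; rewrite expr1n. Qed.

Lemma colon_infty_ideal f : is_ideal (colon_infty J f).
Proof.
split=> [|a g h [M JM] [N JN]]; first by exists 0%N; rewrite mul0r; apply: ideal0.
exists (M + N)%N; rewrite mulrDl exprD; apply: idealD.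
  by rewrite -mulrA; apply: idealMl => //; rewrite mulrA; apply: idealMr.
by rewrite mulrCA; apply: idealMl.
Qed.

Lemma sub_colon_infty f : J `<=` colon_infty J f.
Proof. by move=> g Jg; exists 0%N; rewrite mulr1. Qed.

End IdealTheory.

Lemma ideal_gen_ideal S : is_ideal (ideal_gen S).
Proof.
split=> [|a f g [r [c [s [_ Ss ->]]]] [r' [c' [s' [_ Ss' ->]]]]].
  by exists 0%N, (fun=> 0), (fun=> 0); split=> // [[]|] //; rewrite big_ord0.
exists (r + r')%N, (fun i => match split i with inl j => a * c j | inr j => c' j end),
  (fun i => match split i with inl j => s j | inr j => s' j end); split=> //.
  by move=> i; case: (split i).
rewrite big_split_ord /= mulr_sumr; congr (_ + _); apply: eq_bigr => i _.
  by rewrite (unsplitK (inl _ i)) mulrA.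
by rewrite (unsplitK (inr _ i)).
Qed.

Lemma sub_ideal_gen S : S `<=` ideal_gen S.
Proof.
move=> f Sf; exists 1%N, (fun=> 1), (fun=> f).
by split=> //; rewrite big_ord1 mul1r.
Qed.

Lemma ideal_gen_sub S J : is_ideal J -> S `<=` J -> ideal_gen S `<=` J.
Proof.
move=> idJ SJ f [r [c [s [_ Ss ->]]]].
by apply: ideal_sum => // i _; apply: idealMl => //; apply: SJ.
Qed.

Lemma ideal_add_ideal I J : is_ideal I -> is_ideal J -> is_ideal (ideal_add I J).
Proof.
move=> idI idJ; split=> [|a _ _ [f If [g Jg <-]] [f' If' [g' Jg' <-]]].
  by exists 0; [exact: ideal0 | exists 0; [exact: ideal0 | rewrite addr0]].
exists (a * f + f'); first by case: idI => _; apply.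
exists (a * g + g'); first by case: idJ => _; apply.
by rewrite mulrDr addrACA.
Qed.

Lemma sub_ideal_addl I J : J 0 -> I `<=` ideal_add I J.
Proof. by move=> J0 f If; exists f => //; exists 0 => //; rewrite addr0. Qed.

Lemma sub_ideal_addr I J : I 0 -> J `<=` ideal_add I J.
Proof. by move=> I0 f If; exists 0 => //; exists f => //; rewrite add0r. Qed.

Lemma ideal_add_sub I J P : is_ideal P -> I `<=` P -> J `<=` P ->
  ideal_add I J `<=` P.
Proof. by move=> idP IP JP _ [f If [g Jg <-]]; apply: idealD; auto. Qed.

Lemma prime_idealM P f g : prime_ideal P -> P (f * g) -> P f \/ P g.
Proof.
case=> _ prP Pfg; have := prP f g; rewrite !inE => /(_ Pfg).
by move=> /orP[]; rewrite inE; [left|right].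
Qed.

Lemma prime_idealX P f N : prime_ideal P -> P (f ^+ N) -> P f.
Proof.
move=> prP; elim: N => [|N IHN].
  by rewrite expr0; case: prP => /idealr_closedP[_ ?].
by rewrite exprS => /(prime_idealM prP)[].
Qed.

Lemma prime_ideal_prod P (T : Type) (s : seq T) (B : pred T) (F : T -> R) :
  prime_ideal P -> P (\prod_(i <- s | B i) F i) -> exists2 i, B i & P (F i).
Proof.
move=> prP; elim: s => [|i s IHs].
  by rewrite big_nil; case: prP => /idealr_closedP[_ ?].
by rewrite big_cons; case: ifP => // Bi /(prime_idealM prP)[|/IHs//]; exists i.
Qed.

Lemma primary_is_ideal Q : primary_ideal Q -> is_ideal Q.
Proof. by case=> /idealr_closedP[]. Qed.

Lemma primary_radical_prime Q f g : primary_ideal Q -> radical Q (f * g) ->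
  radical Q f \/ radical Q g.
Proof.
move=> [_ prQ] [N]; rewrite exprMn => /prQ[Qf|[M]]; first by left; exists N.
by rewrite -exprM => Qg; right; exists (N * M)%N.
Qed.

(* For a prime [P], the elements vanishing in the localization of R / I at P. *)
Definition local_kernel I P : set R := [set f | exists s, ~ P s /\ I (s * f)].

Section LocalKernel.
Variables (I P : set R) (idI : is_ideal I) (prP : prime_ideal P).

Lemma local_kernel_ideal : is_ideal (local_kernel I P).
Proof.
split=> [|a f g [s [Ps Is]] [t [Pt It]]].
  exists 1; split; first by case: prP => /idealr_closedP[].
  by rewrite mulr0; apply: ideal0.
exists (s * t); split; first by move=> /(prime_idealM prP)[].
rewrite mulrDr; apply: idealD => //.
  have -> : s * t * (a * f) = (t * a) * (s * f) by ring.
  exact: idealMl.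
by rewrite -mulrA; apply: idealMl.
Qed.

Lemma sub_local_kernel : I `<=` local_kernel I P.
Proof.
move=> f If; exists 1; split; first by case: prP => /idealr_closedP[].
by rewrite mul1r.
Qed.

Lemma local_kernelM s f : ~ P s -> local_kernel I P (s * f) -> local_kernel I P f.
Proof.
move=> Ps [t [Pt It]]; exists (t * s); split; first by move=> /(prime_idealM prP)[].
by rewrite -mulrA.
Qed.

Lemma local_kernel_sub : I `<=` P -> local_kernel I P `<=` P.
Proof. by move=> IP f [s [Ps /IP]] /(prime_idealM prP)[]. Qed.

End LocalKernel.

(* The component at a minimal prime is the local kernel: the other components
   contain an element outside [P]. *)
Lemma minimal_component I P (r : nat) (Q : 'I_r -> set R) :
  prime_ideal P -> I `<=` P ->
  (forall P', prime_ideal P' -> I `<=` P' -> P' `<=` P -> P' = P) ->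
  minimal_primary_decomposition I Q ->
  exists j, radical (Q j) = P /\ Q j = local_kernel I P.
Proof.
move=> prP IP minP [primQ IQ injQ _].
have idQ j := primary_is_ideal (primQ j).
have radP j : radical (Q j) `<=` P -> radical (Q j) = P.
  move=> radjP; apply: minP => //.
    split.
      apply/idealr_closedP; split; first exact: radical_ideal.
      by apply: radical1; case: (primQ j) => /idealr_closedP[].
    move=> f g; rewrite !inE => /(primary_radical_prime (primQ j))[H|H].
      by apply/orP; left; rewrite inE.
    by apply/orP; right; rewrite inE.
  by move=> f If; apply: sub_radical; move: If; rewrite IQ; apply.
(* Otherwise a product of elements of the [Q j] outside [P] would lie in [I], hence in the prime
   [P]. *)
have [j QjP] : exists j, Q j `<=` P.
  apply: contrapT => nQ.
  have /choice[s sP] : forall j, exists s, Q j s /\ ~ P s.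
    move=> j; apply: contrapT => nsj; apply: nQ; exists j => f Qf.
    by apply: contrapT => nPf; apply: nsj; exists f.
  have Is : I (\prod_j s j).
    rewrite IQ => j _; rewrite (bigD1 j) //=.
    by apply: idealMr => //; case: (sP j).
  have [j _] := prime_ideal_prod prP (IP _ Is).
  by case: (sP j).
have radj : radical (Q j) = P.
  by apply: radP => f [N /QjP]; apply: prime_idealX.
exists j; split=> //; apply/seteqP; split=> f.
  move=> Qf; have /choice[s sP] : forall i, exists s, (i != j -> Q i s) /\ ~ P s.
    move=> i; case: (eqVneq i j) => [->|ij].
      by exists 1; split=> //; case: prP => /idealr_closedP[].
    (* If [Q i] were inside [P], its radical would equal [P], which is already the radical of
       [Q j]. *)
    apply: contrapT => nsi; move/eqP: ij; apply; apply: injQ; rewrite radj.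
    apply: radP => g [N Qg]; apply: (prime_idealX (N := N)) => //.
    by apply: contrapT => nPg; apply: nsi; exists (g ^+ N).
  exists (\prod_i s i); split.
    by move=> /(prime_ideal_prod prP)[i _]; case: (sP i).
  rewrite IQ => i _; case: (eqVneq i j) => [->|ij]; first exact: idealMl.
  apply: idealMr => //; rewrite (bigD1 i) //=; apply: idealMr => //.
  by case: (sP i) => /(_ ij).
move=> [s [Ps]]; rewrite IQ => /(_ j Logic.I); rewrite mulrC.
by case: (primQ j) => _ prj /prj[//|]; rewrite radj.
Qed.

(** A weak form of the ascending chain condition: it only forbids chains in which every step is
    strict. *)
Definition noetherian : Prop := forall J : nat -> set R,
  (forall i, is_ideal (J i)) -> (forall i, J i `<=` J i.+1) ->
  exists i, J i.+1 `<=` J i.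

Hypothesis noethR : noetherian.

(** A counterexample could be enlarged strictly to another one; iterating the choice would give a
    strictly ascending chain. *)
Lemma noetherian_ind (A : set R -> Prop) :
  (forall J, is_ideal J ->
     (forall J', is_ideal J' -> J `<=` J' -> ~ J' `<=` J -> A J') -> A J) ->
  forall J, is_ideal J -> A J.
Proof.
move=> indA J0 idJ0; apply: contrapT => nAJ0.
pose T := {J : set R | is_ideal J /\ ~ A J}.
have /choice[F FP] : forall x : T, exists y : T,
    sval x `<=` sval y /\ ~ sval y `<=` sval x.
  move=> [J [idJ nAJ]]; apply: contrapT => nJ; apply: (nAJ); apply: indA => // J' idJ' JJ' J'J.
  by apply: contrapT => nAJ'; apply: nJ; exists (exist _ J' (conj idJ' nAJ')).
pose J i := iter i F (exist _ J0 (conj idJ0 nAJ0)).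
have [i|i|i] := noethR (J := fun i => sval (J i)).
- by case: (svalP (J i)).
- by case: (FP (J i)).
by case: (FP (J i)).
Qed.

Lemma noetherian_max (A : set (set R)) : A `<=` is_ideal -> A !=set0 ->
  exists2 J, A J & forall J', A J' -> J `<=` J' -> J' = J.
Proof.
move=> Aid [J0 AJ0]; apply: contrapT => nmax.
pose B J := ~ A J.
suff H J : is_ideal J -> B J by exact: (H J0 (Aid _ AJ0)).
move: J; apply: noetherian_ind => J idJ IH AJ.
apply: nmax; exists J => // J' AJ' JJ'; apply/seteqP; split=> //.
by apply: contrapT => nJ'J; apply: (IH J') => //; apply: Aid.
Qed.

Definition primary_decomposition I (r : nat) (Q : 'I_r -> set R) : Prop :=
  (forall j, primary_ideal (Q j)) /\ I = \bigcap_j Q j.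

Lemma primary_decomposition_cap I J (r s : nat) (Q : 'I_r -> set R)
    (Q' : 'I_s -> set R) :
  primary_decomposition I Q -> primary_decomposition J Q' ->
  primary_decomposition (I `&` J)
    (fun i => match split i with inl j => Q j | inr j => Q' j end).
Proof.
move=> [primQ ->] [primQ' ->]; split; first by move=> i; case: split.
apply/seteqP; split=> f /=.
  by move=> [Qf Q'f] i _; case: split => j; [apply: Qf | apply: Q'f].
move=> H; split=> j _.
  by have := H (lshift s j) Logic.I; rewrite (unsplitK (inl _ j)).
by have := H (rshift r j) Logic.I; rewrite (unsplitK (inr _ j)).
Qed.

Lemma colonX_sub J f (m n : nat) : is_ideal J -> (m <= n)%N ->
  colon J (f ^+ m) `<=` colon J (f ^+ n).
Proof.
move=> idJ lemn g; rewrite /colon /= -(subnK lemn) exprD mulrCA.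
exact: idealMl.
Qed.

(** Noetherian induction. If [f * g] is in [J], but neither [f] in [J] nor [g] in its radical, the
    ideals [J : g^i] become stable at some [m], and [J] is the intersection of [J : g^(m+1)] and
    [J + (g^(m+1))], both proper and strictly larger. *)
Lemma primary_decomposition_exists I : is_ideal I -> ~ I 1 ->
  exists (r : nat) (Q : 'I_r -> set R), primary_decomposition I Q.
Proof.
move: I; apply: noetherian_ind => J idJ IH J1.
have [primJ|nprim] := pselect (primary_ideal J).
  exists 1%N, (fun=> J); split=> //; apply/seteqP; split=> [f Jf //|f H].
  exact: (H ord0 Logic.I).
have [f [g [Jfg Jf Jg]]] : exists f g, [/\ J (f * g), ~ J f & ~ radical J g].
  apply: contrapT => H; apply: nprim; split; first exact/idealr_closedP.
  move=> f g Jfg; apply: contrapT => /not_orP[Jf Jg]; apply: H.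
  by exists f, g.
have [i|i|m JSm] := noethR (J := fun i => colon J (g ^+ i)).
- exact: colon_ideal.
- exact: colonX_sub.
have {JSm} Jmm N : colon J (g ^+ (N + m)) `<=` colon J (g ^+ m).
  elim: N => [|N IHN] // h Jh; apply: IHN.
  suff /JSm : colon J (g ^+ m.+1) (g ^+ N * h).
    by rewrite /colon /= exprD mulrCA mulrA.
  move: Jh; rewrite /colon /=; congr (J _).
  by rewrite addSn -addnS exprD mulrA (mulrC h).
pose J1' := colon J (g ^+ m.+1).
pose J2 := ideal_add J (ideal_gen [set g ^+ m.+1]).
have idJ1 : is_ideal J1' by exact: colon_ideal.
have idJ2 : is_ideal J2 by apply: ideal_add_ideal => //; exact: ideal_gen_ideal.
have JE : J = J1' `&` J2.
  apply/seteqP; split=> h.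
    move=> Jh; split; first exact: sub_colon.
    by apply: sub_ideal_addl Jh; apply: ideal0; apply: ideal_gen_ideal.
  move=> [J1h [j Jj [_ [r [c [s [_ sg ->]]]]]]].
  have -> : \sum_i c i * s i = (\sum_i c i) * g ^+ m.+1.
    by rewrite mulr_suml; apply: eq_bigr => i _; rewrite (sg i).
  set a := \sum_i c i => hE.
  rewrite -hE; apply: idealD => //.
  (* With [h = j + a g^(m+1)] and [h g^(m+1)] in [J], also [a g^(2m+2)] is in [J]; stability lowers
     the exponent to [m]. *)
  have : colon J (g ^+ (m.+2 + m)) a.
    have Jj' := idealMr idJ (g ^+ m.+1) Jj; rewrite -hE /J1' /colon /= in J1h.
    have E : g ^+ (m.+2 + m) = g ^+ m.+1 * g ^+ m.+1.
      by rewrite -exprD; congr (_ ^+ _); lia.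
    rewrite /colon /=.
    have -> : a * g ^+ (m.+2 + m) = (j + a * g ^+ m.+1) * g ^+ m.+1 - j * g ^+ m.+1.
      by rewrite E; ring.
    exact: idealB.
  by move/Jmm; rewrite /colon /= exprS mulrCA; apply: idealMl.
have [//|||r1 [Q1 Q1P]] := IH J1' idJ1 _ _ _.
- exact: sub_colon.
- move=> /(_ f); rewrite /J1' /colon /= exprS mulrA => H; apply: Jf; apply: H.
  exact: idealMr.
- by rewrite /J1' /colon /= mul1r => H; apply: Jg; exists m.+1.
have [//|||r2 [Q2 Q2P]] := IH J2 idJ2 _ _ _.
- by apply: sub_ideal_addl; apply: ideal0; apply: ideal_gen_ideal.
- move=> /(_ (g ^+ m.+1)) H; apply: Jg; exists m.+1; apply: H.
  by apply: sub_ideal_addr; [exact: ideal0 | exact: sub_ideal_gen].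
(* If [J2] were the unit ideal, [f] would lie in both factors, hence in [J]. *)
- move=> J21; apply: Jf; rewrite JE; split.
    by rewrite /J1' /colon /= exprS mulrA; apply: idealMr.
  by rewrite -[f]mulr1; apply: idealMl.
exists (r1 + r2)%N, (fun i => match split i with inl j => Q1 j | inr j => Q2 j end).
by rewrite JE; apply: primary_decomposition_cap.
Qed.

Lemma primary_idealI Q Q' : primary_ideal Q -> primary_ideal Q' ->
  radical Q = radical Q' -> primary_ideal (Q `&` Q') /\ radical (Q `&` Q') = radical Q.
Proof.
move=> primQ primQ' radQ.
have idQ := primary_is_ideal primQ; have idQ' := primary_is_ideal primQ'.
have radI : radical (Q `&` Q') = radical Q.
  apply/seteqP; split=> f; first by move=> [N []]; exists N.
  move=> Qf; have := Qf; rewrite {1}radQ; case: Qf => M QM [N QN].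
  exists (M + N)%N; rewrite exprD; split; [exact: idealMr | exact: idealMl].
split=> //; split.
  apply/idealr_closedP; split; last by move=> [Q1 _]; case: primQ => /idealr_closedP[].
  split; first by split; exact: ideal0.
  move=> a f g [Qf Q'f] [Qg Q'g].
  by split; [case: idQ => _; apply | case: idQ' => _; apply].
move=> f g [Qfg Q'fg]; rewrite radI.
case: primQ => _ /(_ _ _ Qfg)[Qf|]; last by right.
case: primQ' => _ /(_ _ _ Q'fg)[Q'f|]; last by rewrite radQ; right.
by left.
Qed.

(** A decomposition with the fewest components is minimal: two components with equal radicals could
    be merged, and a redundant one dropped. *)
Lemma minimal_primary_decomposition_exists I : is_ideal I -> ~ I 1 ->
  exists (r : nat) (Q : 'I_r -> set R), minimal_primary_decomposition I Q.
Proof.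
move=> idI I1.
have exr : exists r, `[< exists Q : 'I_r -> set R, primary_decomposition I Q >].
  have [r [Q QP]] := primary_decomposition_exists idI I1.
  by exists r; apply/asboolP; exists Q.
case: (ex_minnP exr) => r /asboolP[Q [primQ IQ]] minr; exists r, Q.
have short s (Q' : 'I_s -> set R) : (s < r)%N -> ~ primary_decomposition I Q'.
  by move=> ltsr H; move: ltsr; rewrite ltnNge minr //; apply/asboolP; exists Q'.
split=> //.
  move=> i j radij; apply: contrapT => /eqP ij.
  case: r => [|r] in Q primQ IQ minr short i j radij ij *; first by case: (i).
  have [primij radij'] := primary_idealI (primQ i) (primQ j) radij.
  (* Index [j] is skipped by [lift j], and its component is absorbed into the one at [i]. *)
  apply: (short r (fun x => let y := lift j x in if y == i then Q i `&` Q j else Q y)) => //.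
  split=> [x /=|]; first by case: ifP.
  rewrite IQ; apply/seteqP; split=> f Qf.
    by move=> x _ /=; case: ifP => _; [split|]; apply: Qf.
  have Qij : (Q i `&` Q j) f.
    case: (unliftP j i) => [x ix|ij']; last by rewrite ij' eqxx in ij.
    by have := Qf x Logic.I; rewrite /= ix eqxx.
  move=> x _; case: (unliftP j x) => [y xy|->]; last by case: Qij.
  have := Qf y Logic.I; rewrite /= -xy; case: ifP => // /eqP -> _.
  by case: Qij.
move=> j Qj; case: r => [|r] in Q primQ IQ minr short j Qj *; first by case: (j).
apply: (short r (fun x => Q (lift j x))) => //.
split=> [x|]; first exact: primQ.
rewrite IQ; apply/seteqP; split=> f Qf; first by move=> x _; apply: Qf.
have Qf' x : x != j -> Q x f.
  case: (unliftP j x) => [y -> _|->]; [exact: Qf | by rewrite eqxx].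
move=> x _; case: (eqVneq x j) => [->|/Qf'//].
by apply: Qj => y /= /Qf'.
Qed.

(** Among the ideals [I : f] with [f] outside the local kernel there is a maximal one. It lies in
    [P] and, by maximality, is prime, so it is an associated prime below [P]. *)
Lemma minimal_prime_associated I P : is_ideal I -> prime_ideal P -> I `<=` P ->
  (forall P', associated_prime I P' -> P' `<=` P -> P' = P) ->
  associated_prime I P.
Proof.
move=> idI prP IP minP.
have [||_ [f Qf <-] maxf] :=
    noetherian_max (A := [set colon I f | f in ~` local_kernel I P]).
- by move=> _ [f _ <-]; apply: colon_ideal.
- exists (colon I 1); exists 1 => // H; have := local_kernel_sub prP IP H.
  by case: prP => /idealr_closedP[].
have [prf sub] : prime_ideal (colon I f) /\ colon I f `<=` P.
  split; last by move=> s Isf; apply: contrapT => Ps; apply: Qf; exists s.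
  split.
    apply/idealr_closedP; split; first exact: colon_ideal.
    rewrite /colon /= => If; apply: Qf; apply: sub_local_kernel => //.
    by move: If; rewrite mul1r.
  have colonM s : colon I f `<=` colon I (s * f).
    by move=> g Ig; rewrite /colon /= mulrCA; apply: idealMl.
  move=> a b; rewrite !inE => Iab.
  (* Either some [s] outside [P] kills [a * f], and then [a] is in [I : (s f) = I : f]; or
     [I : (a f)] competes for maximality, equals [I : f], and contains [b]. *)
  have [[s [Ps Is]]|naf] := pselect (local_kernel I P (a * f)).
    have E : colon I (s * f) = colon I f.
      apply: maxf; last exact: colonM.
      by exists (s * f) => // /(local_kernelM prP Ps).
    apply/orP; left; rewrite inE -E /colon /=.
    by rewrite mulrCA.
  have E : colon I (a * f) = colon I f.
    by apply: maxf; [exists (a * f) | exact: colonM].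
  apply/orP; right; rewrite inE -E /colon /= mulrA.
  by rewrite (mulrC b).
have assf : associated_prime I (colon I f) by split=> //; exists f.
by rewrite -(minP _ assf sub).
Qed.

End CommutativeAlgebra.
(** * Noetherianity of polynomial rings *)

Section Dickson.

(** After each chosen index, take a later one at which [u] is minimal on the remaining tail. *)
Lemma nondecreasing_subseq (u : nat -> nat) : exists s : nat -> nat,
  {homo s : i j / (i < j)%N} /\ {homo u \o s : i j / (i <= j)%N}.
Proof.
have /choice[f fP] : forall N, exists m, (N <= m)%N /\ forall j, (N <= j -> u m <= u j)%N.
  move=> N; have ex : exists x, `[< exists2 m, (N <= m)%N & u m = x >].
    by exists (u N); apply/asboolP; exists N.
  case: (ex_minnP ex) => x /asboolP[m leNm <-] minx; exists m; split=> // j leNj.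
  by apply: minx; apply/asboolP; exists j.
pose s k := iter k (fun x => f x.+1) (f 0%N).
have slt k : (s k < s k.+1)%N by case: (fP (s k).+1).
have s_homo : {homo s : i j / (i < j)%N} by apply: homo_ltn => //; exact: ltn_trans.
exists s; split=> //; apply: homo_leq => //; first exact: leq_trans.
case=> [|k] /=.
  by case: (fP 0%N) => _; apply.
case: (fP (s k).+1) => _; apply.
by apply: (leq_trans (slt k)); apply: ltnW; apply: (slt k.+1).
Qed.

(** Nondecreasing subsequences are extracted for one variable after another; any two terms of the
    last one compare. *)
Lemma dickson (n : nat) (a : nat -> 'X_{1..n}) :
  exists i j, (i < j)%N /\ (a i <= a j)%MM.
Proof.
suff [s [s_homo sP]] : exists s : nat -> nat, {homo s : i j / (i < j)%N} /\
    forall x, x \in enum 'I_n -> {homo (fun k => a (s k) x) : i j / (i <= j)%N}.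
  exists (s 0%N), (s 1%N); split; first exact: s_homo.
  by apply/mnm_lepP => x; apply: sP; rewrite ?mem_enum.
elim: (enum 'I_n) => [|x e [s [s_homo sP]]]; first by exists id; split.
have [t [t_homo tP]] := nondecreasing_subseq (fun k => a (s k) x).
exists (s \o t); split=> [i j ij|y]; first by apply/s_homo/t_homo.
rewrite inE => /orP[/eqP ->|ye i j ij]; first exact: tP.
apply: sP => //; case: (ltngtP i j) ij => // [/t_homo/ltnW//|-> _].
exact: leqnn.
Qed.

(** In a strict chain, let [f i] have the least leading monomial among the elements of [J i.+1]
    outside [J i]. Dickson's lemma gives [i < j] such that the leading monomial of [f i] divides
    that of [f j]; cancelling the leading term of [f j] contradicts its choice. *)
Lemma mpoly_noetherian (n : nat) (F : fieldType) : noetherian {mpoly F[n]}.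
Proof.
move=> J idJ subJ; apply: contrapT => strict.
have /choice[f fP] : forall i, exists f, [/\ J i.+1 f, ~ J i f &
    forall g, J i.+1 g -> ~ J i g -> ~~ (mlead g < mlead f)%O].
  move=> i; apply: contrapT => nof; apply: strict; exists i => f.
  move: {2}(mlead f) (erefl (mlead f)) => m.
  elim: (ltom_wf m) f => {}m _ IHm f fm Jf.
  apply: contrapT => nJf; apply: nof; exists f; split=> // g Jg nJg.
  by apply/negP; rewrite fm => /IHm/(_ g erefl Jg).
have Jmono i j : (i <= j)%N -> J i `<=` J j.
  elim: j => [|j IHj]; first by rewrite leqn0 => /eqP ->.
  by rewrite leq_eqVlt => /orP[/eqP ->//|/IHj/subset_trans]; apply.
have [i [j [ltij leij]]] := dickson (fun i => mlead (f i)).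
have [Jfi nJfi _] := fP i; have [Jfj nJfj minj] := fP j.
have fi0 : f i != 0 by apply/eqP => fi0; apply: nJfi; rewrite fi0; apply: ideal0.
have fj0 : f j != 0 by apply/eqP => fj0; apply: nJfj; rewrite fj0; apply: ideal0.
pose h := (mleadc (f j) / mleadc (f i))%:MP * 'X_[(mlead (f j) - mlead (f i))] * f i.
have Jh : J j h by apply: idealMl => //; apply: (Jmono i.+1).
apply: (negP (minj (f j - h) _ _)).
- by apply: idealB => //; apply: subJ.
- by move=> Jfjh; apply: nJfj; apply: idealBr Jfjh Jh.
have lh : (mlead h <= mlead (f j))%O.
  rewrite /h -mulrA -[X in (_ <= X)%O](submK leij); apply: (le_trans (mleadM_le _ _)).
  by rewrite mleadC add0m; apply: (le_trans (mleadM_le _ _)); rewrite mleadXm.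
have lch : h@_(mlead (f j)) = mleadc (f j).
  rewrite /h -mulrA mcoeffCM mulrC (mulrC 'X_[_]) -{1}(submK leij) mcoeffMX.
  by rewrite mulrC divfK ?mleadc_eq0.
have fjh : f j - h != 0.
  rewrite subr_eq0; apply/eqP => E; apply: nJfj; rewrite E //.
rewrite lt_neqAle; apply/andP; split.
  apply/eqP => E; have := mlead_supp fjh; rewrite E mcoeff_msupp mcoeffB lch.
  by rewrite subrr eqxx.
by apply: (le_trans (mleadB_le _ _)); rewrite leUx lexx.
Qed.

End Dickson.
(** * Binomial ideals and congruences of monomials *)

Section LinearExtension.
Variables (n : nat) (k : fieldType).
Implicit Types (u v w m : 'X_{1..n}) (f g b : {mpoly k[n]}) (J S : set {mpoly k[n]}).

Definition mlin (V : lmodType k) (phi : 'X_{1..n} -> V) f : V :=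
  \sum_(m <- msupp f) f@_m *: phi m.

Section Mlin.
Variables (V : lmodType k) (phi : 'X_{1..n} -> V).

Lemma mlinE s f : uniq s -> {subset msupp f <= s} ->
  mlin phi f = \sum_(m <- s) f@_m *: phi m.
Proof.
move=> us sub; rewrite (bigID (mem (msupp f))) /= [X in _ + X]big1 ?addr0.
  rewrite -[RHS]big_filter; apply: perm_big; apply: uniq_perm.
  - exact: msupp_uniq.
  - exact: filter_uniq.
  by move=> m; rewrite mem_filter; case: (boolP (m \in msupp f)) => //= /sub ->.
by move=> m; rewrite mcoeff_msupp negbK => /eqP ->; rewrite scale0r.
Qed.

Lemma mlinP a f g : mlin phi (a *: f + g) = a *: mlin phi f + mlin phi g.
Proof.
pose s := undup (msupp f ++ msupp g ++ msupp (a *: f + g)).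
have sub h : {subset msupp h <= msupp f ++ msupp g ++ msupp (a *: f + g)} ->
    mlin phi h = \sum_(m <- s) h@_m *: phi m.
  by move=> H; apply: mlinE; [exact: undup_uniq | move=> m /H; rewrite mem_undup].
rewrite !sub; last 3 first.
- by move=> m mg; rewrite !mem_cat mg orbT.
- by move=> m mf; rewrite mem_cat mf.
- by move=> m mh; rewrite !mem_cat mh !orbT.
rewrite scaler_sumr -big_split; apply: eq_bigr => m _ /=.
by rewrite mcoeffD mcoeffZ scalerDl scalerA.
Qed.

Lemma mlin0 : mlin phi 0 = 0.
Proof. by rewrite /mlin big1 // => m _; rewrite mcoeff0 scale0r. Qed.

Lemma mlinD f g : mlin phi (f + g) = mlin phi f + mlin phi g.
Proof. by have := mlinP 1 f g; rewrite !scale1r. Qed.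

Lemma mlinZ a f : mlin phi (a *: f) = a *: mlin phi f.
Proof. by have := mlinP a f 0; rewrite mlin0 !addr0. Qed.

Lemma mlinB f g : mlin phi (f - g) = mlin phi f - mlin phi g.
Proof. by have := mlinP (-1) g f; rewrite !scaleN1r ![- _ + _]addrC. Qed.

Lemma mlinX m : mlin phi 'X_[m] = phi m.
Proof. by rewrite /mlin msuppX big_seq1 mcoeffX eqxx scale1r. Qed.

End Mlin.

(** Expanding the coefficients into monomials makes an ideal the linear span of the monomial
    multiples of its generators. *)
Lemma ideal_gen_ind S (A : {mpoly k[n]} -> Prop) :
  A 0 -> (forall a f g, A f -> A g -> A (a *: f + g)) ->
  (forall m s, S s -> A ('X_[m] * s)) -> forall f, ideal_gen S f -> A f.
Proof.
move=> A0 AP AS f [r [c [s [_ Ss ->]]]].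
have AD g h : A g -> A h -> A (g + h) by move=> Ag; rewrite -[g]scale1r; apply: AP.
elim/big_ind: _ => // i _; rewrite (mpolyE (c i)) mulr_suml.
elim/big_ind: _ => // m _; rewrite -scalerAl -[_ *: _]addr0.
by apply: AP => //; apply: AS.
Qed.

Section Ideal.
Variables (J : set {mpoly k[n]}) (idJ : is_ideal J).

Lemma idealZ c f : J f -> J (c *: f).
Proof. by rewrite -mul_mpolyC; apply: idealMl. Qed.

Lemma idealZK c f : c != 0 -> J (c *: f) -> J f.
Proof. by move=> c0 /(idealZ c^-1); rewrite scalerA mulVf // scale1r. Qed.

Lemma ideal_congr_sym c u v : c != 0 ->
  J ('X_[u] - c *: 'X_[v]) -> J ('X_[v] - c^-1 *: 'X_[u]).
Proof.
move=> c0 /(idealZ (- c^-1)).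
by rewrite scalerBr scalerA mulNr mulVf // !scaleNr scale1r opprK addrC.
Qed.

Lemma ideal_congr_trans c d u v w :
  J ('X_[u] - c *: 'X_[v]) -> J ('X_[v] - d *: 'X_[w]) ->
  J ('X_[u] - (c * d) *: 'X_[w]).
Proof.
move=> Juv /(idealZ c) /(idealD idJ Juv).
by rewrite scalerBr scalerA addrA subrK.
Qed.

Lemma ideal_congrD c u v w :
  J ('X_[u] - c *: 'X_[v]) -> J ('X_[w + u] - c *: 'X_[w + v]).
Proof. by move=> /(idealMl idJ 'X_[w]); rewrite mulrBr -scalerAr -!mpolyXD. Qed.

Lemma ideal_congr_refl u : J ('X_[u] - 1 *: 'X_[u]).
Proof. by rewrite scale1r subrr; apply: ideal0. Qed.

Lemma ideal_congr_uniq c d u v : ~ J 'X_[v] ->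
  J ('X_[u] - c *: 'X_[v]) -> J ('X_[u] - d *: 'X_[v]) -> c = d.
Proof.
move=> Jv Jc Jd; apply/eqP; rewrite eq_sym -subr_eq0.
apply: contrapT => /negP cd; apply: Jv; apply: (idealZK cd).
by have := idealB idJ Jc Jd; rewrite opprB addrC addrA subrK -scalerBl.
Qed.

Lemma ideal_congrX c u v : c != 0 -> J ('X_[u] - c *: 'X_[v]) -> J 'X_[u] -> J 'X_[v].
Proof. by move=> c0 Juv Ju; apply: (idealZK c0); apply: idealBl Juv Ju. Qed.

Lemma binomialP b : (size (msupp b) <= 2)%N -> [\/ b = 0,
  exists a v, a != 0 /\ b = a *: 'X_[v] |
  exists a c v w, [/\ a != 0, c != 0, v != w & b = a *: ('X_[v] - c *: 'X_[w])]].
Proof.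
have := mpolyE b; have := msupp_uniq b; have := @mcoeff_msupp _ _ b.
case: (msupp b) => [|v [|w []]] //= bE.
- by rewrite big_nil => _ b0 _; apply: Or31.
- rewrite big_seq1 => _ bX _; apply: Or32; exists b@_v, v.
  by split=> //; rewrite -bE inE eqxx.
rewrite inE andbT big_cons big_seq1 => vw bX _; apply: Or33.
have bv : b@_v != 0 by rewrite -bE inE eqxx.
have bw : b@_w != 0 by rewrite -bE !inE eqxx orbT.
exists b@_v, (- ((b@_v)^-1 * b@_w)), v, w; split=> //.
  by rewrite oppr_eq0 mulf_neq0 ?invr_eq0.
by rewrite {1}bX scaleNr opprK scalerDr scalerA mulrA divff // mul1r.
Qed.

Lemma size_msuppMX m b : size (msupp ('X_[m] * b)) = size (msupp b).
Proof. by rewrite mulrC (perm_size (msuppMX b m)) size_map. Qed.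

(* Binomial ideals in terms of the congruence they induce on monomials: every
   term of a member of [J] lies in [J] or is congruent to another term. *)
Definition binomial_exchange : Prop := forall f u, J f -> u \in msupp f ->
  J 'X_[u] \/ exists v c, [/\ v \in msupp f, v != u, c != 0 &
                              J ('X_[u] - c *: 'X_[v])].

End Ideal.

(** Suppose [x^u] is not in the ideal. Sending [x^v] to the scalar [c] with [x^v] congruent to
    [c x^u], and to 0 if there is none, defines a linear form that kills the ideal but is 1 at
    [x^u]. Hence it is nonzero at another term of [f]. *)
Lemma binomial_ideal_exchange S : (forall s, S s -> size (msupp s) <= 2)%N ->
  binomial_exchange (ideal_gen S).
Proof.
move=> S2 f u Jf uf; set J := ideal_gen S.
have idJ : is_ideal J := ideal_gen_ideal S.
have [|Ju] := pselect (J 'X_[u]); first by left.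
right; pose A v c := J ('X_[v] - c *: 'X_[u]).
have Auniq v c d : A v c -> A v d -> c = d by apply: ideal_congr_uniq.
have /choice[phi phiP] : forall v, exists c : k^o,
    A v c \/ (c = 0 /\ forall d, ~ A v d).
  move=> v; have [[c Ac]|nA] := pselect (exists c, A v c); first by exists c; left.
  by exists 0; right; split=> // d Ad; apply: nA; exists d.
have phiE v c : A v c -> phi v = c.
  by move=> Ac; case: (phiP v) => [/Auniq/(_ Ac)//|[_ /(_ c)]].
(* Either both monomials of a binomial in [J] are congruent to multiples of [x^u], compatibly, or
   neither is. *)
have phi_bin b : J b -> (size (msupp b) <= 2)%N -> mlin phi b = 0.
  move=> Jb /binomialP[->|[a [v [a0 bE]]]|[a [c [v [w [a0 c0 vw bE]]]]]].
  - by rewrite mlin0.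
  - rewrite bE mlinZ mlinX (phiE v 0) ?scaler0 //.
    by rewrite /A scale0r subr0; apply: (idealZK idJ a0); rewrite -bE.
  rewrite bE mlinZ mlinB mlinZ !mlinX.
  have Jvw : J ('X_[v] - c *: 'X_[w]) by apply: (idealZK idJ a0); rewrite -bE.
  have [Aw|[w0 nAw]] := phiP w.
    by rewrite (phiE _ _ (ideal_congr_trans idJ Jvw Aw)) subrr scaler0.
  have [Av|[v0 _]] := phiP v; last by rewrite v0 w0 scaler0 subr0 scaler0.
  by have := ideal_congr_trans idJ (ideal_congr_sym idJ c0 Jvw) Av => /nAw.
have phif : mlin phi f = 0.
  move: f Jf {uf}; apply: ideal_gen_ind => [|a f g f0 g0|m s Ss].
  - exact: mlin0.
  - by rewrite mlinP f0 g0 scaler0 addr0.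
  apply: phi_bin; last by rewrite size_msuppMX S2.
  by apply: idealMl => //; apply: sub_ideal_gen.
have phiu : phi u = 1 by apply: phiE; apply: ideal_congr_refl.
apply: contrapT => nov; move: phif.
rewrite /mlin (bigD1_seq u) ?msupp_uniq //= phiu big_seq_cond big1 ?addr0.
  by move=> /eqP; rewrite scaler_eq0 oner_eq0 orbF -[_ == 0]negbK -mcoeff_msupp uf.
move=> v /andP[vf vu]; have [->|phiv] := eqVneq (phi v) 0; first by rewrite scaler0.
case: nov; exists v, (phi v)^-1; split; rewrite ?invr_eq0 //.
apply: ideal_congr_sym => //; case: (phiP v) => [//|[v0]].
by rewrite v0 eqxx in phiv.
Qed.

(** Projection onto the span of the monomials in [B]. If [B] is a union of congruence classes, it
    preserves a binomial ideal; a binomial of the ideal with only one monomial in [B] then puts that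
    monomial into the ideal. *)
Definition restrict (B : set 'X_{1..n}) : {mpoly k[n]} -> {mpoly k[n]} :=
  mlin (fun m => if `[< B m >] then 'X_[m] else 0).

Lemma restrict_binomial J (B : set 'X_{1..n}) b :
  is_ideal J ->
  (forall v w c, c != 0 -> J ('X_[v] - c *: 'X_[w]) -> B v -> B w) ->
  J b -> (size (msupp b) <= 2)%N -> J (restrict B b).
Proof.
move=> idJ JB Jb /binomialP[->|[a [v [a0 bE]]]|[a [c [v [w [a0 c0 vw bE]]]]]].
- by rewrite /restrict mlin0; apply: ideal0.
- move: Jb; rewrite bE /restrict mlinZ mlinX => Jb.
  by case: asboolP => // _; rewrite scaler0; apply: ideal0.
have Jvw : J ('X_[v] - c *: 'X_[w]) by apply: (idealZK idJ a0); rewrite -bE.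
move: Jb; rewrite bE /restrict mlinZ mlinB mlinZ !mlinX => Jb.
case: asboolP => [Bv|nBv]; case: asboolP => [Bw|nBw] //.
- by case: nBw; apply: (JB v w c).
- by case: nBv; apply: (JB w v c^-1); rewrite ?invr_eq0 //; apply: ideal_congr_sym.
by rewrite scaler0 subr0 scaler0; apply: ideal0.
Qed.

Lemma restrict_ideal_gen J S (B : set 'X_{1..n}) : is_ideal J ->
  (forall m s, S s -> J (restrict B ('X_[m] * s))) ->
  forall f, ideal_gen S f -> J (restrict B f).
Proof.
move=> idJ JS; apply: ideal_gen_ind => [|a f g Jf Jg|//].
  by rewrite /restrict mlin0; apply: ideal0.
by rewrite /restrict mlinP; apply: idealD => //; apply: idealZ.
Qed.

Lemma restrict_congr (B : set 'X_{1..n}) c u v : B u -> ~ B v ->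
  restrict B ('X_[u] - c *: 'X_[v]) = 'X_[u].
Proof.
move=> Bu Bv; rewrite /restrict mlinB mlinZ !mlinX.
by rewrite (asboolT Bu) (asboolF Bv) scaler0 subr0.
Qed.

End LinearExtension.
(** * Lattices and partial characters *)

Section MonomialDifferences.
Variable n : nat.
Implicit Types (u v w : 'X_{1..n}) (D : {set 'I_n}).

Lemma mnm_diffuu u : mnm_diff u u = 0.
Proof. by apply/rowP => i; rewrite !mxE subrr. Qed.

Lemma mnm_diffN u v : - mnm_diff u v = mnm_diff v u.
Proof. by apply/rowP => i; rewrite !mxE opprB. Qed.

Lemma mnm_diffD u v u' v' :
  mnm_diff (u + u')%MM (v + v')%MM = mnm_diff u v + mnm_diff u' v'.
Proof. by apply/rowP => i; rewrite !mxE !mnmDE !PoszD; ring. Qed.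

Lemma mnm_diffDl u v w : mnm_diff (w + u)%MM (w + v)%MM = mnm_diff u v.
Proof. by rewrite mnm_diffD mnm_diffuu add0r. Qed.

Lemma mnm_diffDr u v w : mnm_diff (u + w)%MM (v + w)%MM = mnm_diff u v.
Proof. by rewrite mnm_diffD mnm_diffuu addr0. Qed.

Lemma mnm_diff_trans v u w : mnm_diff u v + mnm_diff v w = mnm_diff u w.
Proof. by rewrite -mnm_diffD addmC mnm_diffDl. Qed.

Lemma mnm_diffMn u v N : mnm_diff (u *+ N)%MM (v *+ N)%MM = mnm_diff u v *+ N.
Proof.
elim: N => [|N IHN]; first by rewrite !mulm0n mnm_diffuu.
by rewrite !mulmS mnm_diffD IHN mulrS.
Qed.

Lemma mnm_diff_eq u v u' v' : mnm_diff u v = mnm_diff u' v' -> (u + v' = u' + v)%MM.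
Proof.
move=> /rowP E; apply/mnmP => i; have := E i; rewrite !mxE !mnmDE; lia.
Qed.

Lemma Npow0 D : Npow D 0%MM.
Proof. by move=> i _; rewrite mnm0E. Qed.

Lemma NpowD D u v : Npow D (u + v)%MM <-> Npow D u /\ Npow D v.
Proof.
split=> [H|[Du Dv] i iD]; last by rewrite mnmDE Du // Dv.
by split=> i /H; rewrite mnmDE; lia.
Qed.

Lemma NpowMn D u N : Npow D u -> Npow D (u *+ N)%MM.
Proof. by move=> Du i /Du; rewrite mulmnE => ->. Qed.

Lemma not_NpowP D u : ~ Npow D u -> exists2 i, i \notin D & (U_(i) <= u)%MM.
Proof.
move=> nDu; apply: contrapT => ni; apply: nDu => i iD; apply: contrapT => /eqP ui.
by apply: ni; exists i; rewrite ?lep1mP.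
Qed.

Lemma mnm_split D u : exists a w, [/\ Npow (~: D) a, Npow D w & u = (a + w)%MM].
Proof.
exists [multinom if i \in D then 0%N else u i | i < n].
exists [multinom if i \in D then u i else 0%N | i < n].
split=> [i|i|]; rewrite ?mnmE ?inE.
- by rewrite negbK => ->.
- by move=> /negPf ->.
by apply/mnmP => i; rewrite mnmDE !mnmE; case: ifP; rewrite ?addn0.
Qed.

Lemma Npow_mdiff D u v : Npow D u -> Npow D v -> Zpow D (mnm_diff u v).
Proof. by move=> Du Dv i iD; rewrite mxE Du // Dv. Qed.

Lemma Zpow_mnm_diff D s : Zpow D s ->
  exists u v, [/\ Npow D u, Npow D v & s = mnm_diff u v].
Proof.
move=> Ds; exists [multinom absz (Num.max (s 0 i) 0)%R | i < n].
exists [multinom absz (Num.max (- s 0 i) 0)%R | i < n].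
split=> [i iD|i iD|]; rewrite ?mnmE ?Ds //.
by apply/rowP => i; rewrite !mxE !mnmE; lia.
Qed.

End MonomialDifferences.

Section Lattices.
Variables (n : nat) (D : {set 'I_n}) (L : set 'rV[int]_n).
Hypothesis latL : lattice D L.
Implicit Types s t : 'rV[int]_n.

Lemma lattice0 : L 0.
Proof. by case: latL => [[+ _] _]; rewrite inE. Qed.

Lemma latticeB s t : L s -> L t -> L (s - t).
Proof. by case: latL => [[_ LB] _] Ls Lt; have := LB s t; rewrite !inE; apply. Qed.

Lemma latticeN s : L s -> L (- s).
Proof. by move=> Ls; rewrite -sub0r; apply: latticeB => //; apply: lattice0. Qed.

Lemma latticeD s t : L s -> L t -> L (s + t).
Proof. by move=> Ls /latticeN Lt; rewrite -(opprK t); apply: latticeB. Qed.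

Lemma latticeMn s N : L s -> L (s *+ N).
Proof.
move=> Ls; elim: N => [|N IHN]; first exact: lattice0.
by rewrite mulrS; apply: latticeD.
Qed.

Lemma lattice_sum (T : Type) (r : seq T) (F : T -> 'rV[int]_n) :
  (forall i, L (F i)) -> L (\sum_(i <- r) F i).
Proof.
by move=> LF; elim/big_ind: _ => //; [exact: lattice0 | exact: latticeD].
Qed.

Lemma lattice_mulz s (z : int) : L s -> L (s *~ z).
Proof.
case: z => N Ls; first exact: latticeMn.
by rewrite NegzE mulrNz; apply/latticeN/latticeMn.
Qed.

Lemma sub_Zpow : L `<=` Zpow D.
Proof. by case: latL. Qed.

End Lattices.

(** * Lattice ideals of partial characters *)

Section PartialCharacters.
Variables (n : nat) (k : closedFieldType) (D : {set 'I_n}).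
Variables (L : set 'rV[int]_n) (rho : 'rV[int]_n -> k).
Hypothesis rhoP : partial_character D L rho.

Lemma character_lattice : lattice D L. Proof. by case: rhoP. Qed.

Lemma character_neq0 s : L s -> rho s != 0.
Proof. by case: rhoP => _ + _; apply. Qed.

Lemma characterD s t : L s -> L t -> rho (s + t) = rho s * rho t.
Proof. by case: rhoP => _ _; apply. Qed.

Lemma character0 : rho 0 = 1.
Proof.
have L0 := lattice0 character_lattice; apply: (mulfI (character_neq0 L0)).
by rewrite -characterD // addr0 mulr1.
Qed.

Lemma characterN s : L s -> rho (- s) = (rho s)^-1.
Proof.
move=> Ls; apply: (mulfI (character_neq0 Ls)).
rewrite -characterD //; last exact: (latticeN character_lattice).
by rewrite subrr character0 divff // character_neq0.
Qed.

Lemma characterMn s N : L s -> rho (s *+ N) = rho s ^+ N.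
Proof.
move=> Ls; elim: N => [|N IHN]; first by rewrite mulr0n expr0 character0.
by rewrite mulrS characterD ?IHN ?exprS //; apply: (latticeMn character_lattice) _ Ls.
Qed.

Definition lattice_binomials : set {mpoly k[n]} :=
  [set f | exists u v, [/\ Npow D u, Npow D v, L (mnm_diff u v) &
                        f = 'X_[u] - rho (mnm_diff u v) *: 'X_[v]]].

Lemma lattice_binomial_ideal u v : Npow D u -> Npow D v -> L (mnm_diff u v) ->
  lattice_ideal D L rho ('X_[u] - rho (mnm_diff u v) *: 'X_[v]).
Proof.
move=> Du Dv Luv; exists 1%N, (fun=> 1), (fun=> 'X_[u] - rho (mnm_diff u v) *: 'X_[v]).
split=> [_ m|_|]; last by rewrite big_ord1 mul1r.
  by rewrite msupp1 inE => /eqP ->; apply: Npow0.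
by exists u, v.
Qed.

Lemma ideal_gen_lattice_ideal :
  ideal_gen (lattice_ideal D L rho) = ideal_gen lattice_binomials.
Proof.
apply/seteqP; split; apply: ideal_gen_sub; try exact: ideal_gen_ideal.
  by move=> f [r [c [s [_ Ss ->]]]]; exists r, c, s.
by move=> _ [u [v [Du Dv Luv ->]]]; apply/sub_ideal_gen/lattice_binomial_ideal.
Qed.

Lemma sub_lattice_ideal (J : set {mpoly k[n]}) : is_ideal J ->
  (forall u v, Npow D u -> Npow D v -> L (mnm_diff u v) ->
     J ('X_[u] - rho (mnm_diff u v) *: 'X_[v])) ->
  ideal_gen (lattice_ideal D L rho) `<=` J.
Proof.
move=> idJ JL; rewrite ideal_gen_lattice_ideal; apply: ideal_gen_sub => //.
by move=> _ [u [v [Du Dv Luv ->]]]; apply: JL.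
Qed.

Lemma lattice_ideal_polysub : lattice_ideal D L rho `<=` polysub D.
Proof.
move=> _ [r [c [s [Dc Ss ->]]]] m.
move=> /msupp_sum_le/flatten_mapP[i _].
move=> /msuppM_le/allpairsP[[a b] /= [ac bs ->]]; apply/NpowD; split; first exact: Dc ac.
case: (Ss i) => u [v [Du Dv _ sE]]; move: bs; rewrite sE.
move=> /msuppB_le; rewrite mem_cat msuppX inE => /orP[/eqP ->//|/msuppZ_le].
by rewrite msuppX inE => /eqP ->.
Qed.

Lemma size_lattice_binomial s : lattice_binomials s -> (size (msupp s) <= 2)%N.
Proof.
move=> [u [v [_ _ _ ->]]].
have sub : {subset msupp ('X_[u] - rho (mnm_diff u v) *: 'X_[v]) <= [:: u; v]}.
  move=> m /msuppB_le; rewrite mem_cat msuppX !inE => /orP[->//|/msuppZ_le].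
  by rewrite msuppX inE orbC => ->.
exact: (uniq_leq_size (msupp_uniq _) sub).
Qed.

(* The linear form detecting the class of [x^u] modulo the lattice ideal. *)
Definition class_form (u v : 'X_{1..n}) : k^o :=
  if `[< Npow D v /\ L (mnm_diff v u) >] then rho (mnm_diff v u) else 0.

Lemma class_form_binomial u a b m : Npow D a -> Npow D b -> L (mnm_diff a b) ->
  mlin (class_form u) ('X_[m] * ('X_[a] - rho (mnm_diff a b) *: 'X_[b])) = 0.
Proof.
move=> Da Db Lab; have latL := character_lattice.
rewrite mulrBr -scalerAr -!mpolyXD mlinB mlinZ !mlinX /class_form.
case: (asboolP (Npow D (m + b)%MM /\ _)) => [[/NpowD[Dm _] Lb]|nb].
  have La : L (mnm_diff (m + a)%MM u).
    by rewrite -(mnm_diff_trans (m + b)%MM) mnm_diffDl; apply: (latticeD latL).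
  rewrite asboolT; last by split=> //; apply/NpowD.
  rewrite -(mnm_diff_trans (m + b)%MM (m + a)%MM) mnm_diffDl.
  by rewrite characterD // subrr.
rewrite asboolF ?scaler0 ?subrr // => -[/NpowD[Dm _] La]; apply: nb.
split; first exact/NpowD.
have -> : mnm_diff (m + b)%MM u = mnm_diff b a + mnm_diff (m + a)%MM u.
  by rewrite -(mnm_diffDl b a m) mnm_diff_trans.
by apply: (latticeD latL) => //; rewrite -mnm_diffN; apply: (latticeN latL).
Qed.

Lemma class_form_lattice_ideal u f : ideal_gen (lattice_ideal D L rho) f ->
  mlin (class_form u) f = 0.
Proof.
rewrite ideal_gen_lattice_ideal; move: f.
apply: ideal_gen_ind => [|a f g f0 g0|m _ [a [b [Da Db Lab ->]]]].
- exact: mlin0.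
- by rewrite mlinP f0 g0 scaler0 addr0.
exact: class_form_binomial.
Qed.

Lemma class_form_id u : Npow D u -> class_form u u = 1.
Proof.
move=> Du; rewrite /class_form mnm_diffuu character0 asboolT //; split=> //.
exact: lattice0 character_lattice.
Qed.

(** The form is 1 at [x^u], so it cannot vanish at [x^v]; its value there determines [c]. *)
Lemma class_form_congr u v c : Npow D u ->
  mlin (class_form u) ('X_[u] - c *: 'X_[v]) = 0 ->
  [/\ Npow D v, L (mnm_diff u v) & c = rho (mnm_diff u v)].
Proof.
move=> Du; rewrite mlinB mlinZ !mlinX class_form_id // /class_form.
case: asboolP => [[Dv Lv]|_]; last first.
  by rewrite scaler0 subr0 => /eqP; rewrite oner_eq0.
move=> /eqP; rewrite subr_eq0 => /eqP c1.
have Luv : L (mnm_diff u v) by rewrite -mnm_diffN; apply: latticeN character_lattice _ Lv.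
split=> //; rewrite -mnm_diffN characterN //; apply: (mulIf (character_neq0 Lv)).
by rewrite mulVf ?character_neq0 // c1.
Qed.

End PartialCharacters.

(* A saturated proper ideal defines a partial character: the binomials
   [x^u - c x^v] over N^D that it contains only depend on [u - v]. *)
Section SaturatedIdeals.
Variables (n : nat) (k : closedFieldType) (D : {set 'I_n}).
Implicit Types (Q : set {mpoly k[n]}) (u v w : 'X_{1..n}).

Definition saturated Q : Prop := forall w f, Npow D w -> Q ('X_[w] * f) -> Q f.

Definition ideal_ratio Q (s : 'rV[int]_n) (c : k) : Prop :=
  exists u v, [/\ Npow D u, Npow D v, s = mnm_diff u v & Q ('X_[u] - c *: 'X_[v])].

Definition ideal_lattice Q : set 'rV[int]_n := [set s | exists c, ideal_ratio Q s c].

Variables (Q : set {mpoly k[n]}) (idQ : is_ideal Q).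
Hypotheses (properQ : ~ Q 1) (satQ : saturated Q).

Lemma saturated_monomial u : Npow D u -> ~ Q 'X_[u].
Proof. by move=> Du Qu; apply: properQ; apply: (satQ Du); rewrite mulr1. Qed.

(** Two binomials with the same exponent difference and scalar agree after multiplication by
    monomials over N^D, which saturation cancels. *)
Lemma ideal_ratio_binomial s c u v : Npow D u -> Npow D v -> s = mnm_diff u v ->
  ideal_ratio Q s c -> Q ('X_[u] - c *: 'X_[v]).
Proof.
move=> Du Dv -> [u0 [v0 [Du0 Dv0 /mnm_diff_eq E Q0]]]; apply: (satQ Dv0).
by rewrite mulrBr -scalerAr -!mpolyXD addmC E addmC (addmC v0); apply: ideal_congrD.
Qed.

Lemma ideal_ratio_uniq s c d : ideal_ratio Q s c -> ideal_ratio Q s d -> c = d.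
Proof.
move=> [u [v [Du Dv -> Qc]]] /(ideal_ratio_binomial Du Dv erefl).
exact: ideal_congr_uniq (saturated_monomial Dv) Qc.
Qed.

Lemma ideal_ratio_neq0 s c : ideal_ratio Q s c -> c != 0.
Proof.
move=> [u [v [Du _ _ Qc]]]; apply/eqP => c0; apply: (saturated_monomial Du).
by move: Qc; rewrite c0 scale0r subr0.
Qed.

Lemma ideal_ratio0 : ideal_ratio Q 0 1.
Proof.
exists 0%MM, 0%MM; split; [exact: Npow0|exact: Npow0|by rewrite mnm_diffuu|].
exact: ideal_congr_refl.
Qed.

Lemma ideal_ratioD s c t d : ideal_ratio Q s c -> ideal_ratio Q t d ->
  ideal_ratio Q (s + t) (c * d).
Proof.
move=> [u [v [Du Dv -> Qc]]] [u' [v' [Du' Dv' -> Qd]]].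
exists (u + u')%MM, (v + v')%MM; rewrite mnm_diffD; split=> //; try exact/NpowD.
apply: (ideal_congr_trans idQ (v := (v + u')%MM)); last exact: ideal_congrD.
by rewrite addmC (addmC v); apply: ideal_congrD.
Qed.

Lemma ideal_ratioN s c : ideal_ratio Q s c -> ideal_ratio Q (- s) c^-1.
Proof.
move=> Qsc; have c0 := ideal_ratio_neq0 Qsc.
case: Qsc => u [v [Du Dv -> Qc]]; exists v, u; rewrite mnm_diffN; split=> //.
exact: ideal_congr_sym.
Qed.

Lemma saturated_character : exists chi : 'rV[int]_n -> k,
  partial_character D (ideal_lattice Q) chi /\
  forall s, ideal_lattice Q s -> ideal_ratio Q s (chi s).
Proof.
have /choice[chi chiP] : forall s, exists c, ideal_lattice Q s -> ideal_ratio Q s c.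
  move=> s; have [[c Qc]|nQ] := pselect (ideal_lattice Q s); first by exists c.
  by exists 0 => /nQ.
exists chi; split=> //; split.
- split; first split.
  + by rewrite inE; exists 1; exact: ideal_ratio0.
  + move=> s t; rewrite !inE => -[c Qc] [d /ideal_ratioN Qd].
    by exists (c * d^-1); apply: ideal_ratioD.
  by move=> s [c [u [v [Du Dv -> _]]]]; apply: Npow_mdiff.
- by move=> s /chiP/ideal_ratio_neq0.
move=> s t Qs Qt; apply: (@ideal_ratio_uniq (s + t)).
  by apply: (chiP); exists (chi s * chi t); apply: ideal_ratioD; apply: (chiP).
by apply: ideal_ratioD; apply: (chiP).
Qed.

End SaturatedIdeals.
(** * Saturation of lattices *)

Section Saturation.
Variables (n : nat) (D : {set 'I_n}).
Implicit Types (L : set 'rV[int]_n) (s v : 'rV[int]_n).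
Local Notation rat_mx := (map_mx (intr : int -> rat)).

Lemma row_free_lattice_rank L (r : nat) (M : 'M[int]_(r, n)) :
  (forall i, L (row i M)) -> row_free (rat_mx M) -> (r <= lattice_rank L)%N.
Proof.
move=> LM freeM.
have ltrn : (r < n.+1)%N by rewrite ltnS -(eqP freeM) rank_leq_col.
rewrite /lattice_rank; apply: (leq_bigmax_cond (Ordinal ltrn)).
by apply/asboolP; exists M.
Qed.

Lemma lattice_rows_extend L (r : nat) (B : 'M[int]_(r, n)) v :
  (forall i, L (row i B)) -> L v -> forall i, L (row i (col_mx B v)).
Proof.
by move=> LB Lv i; case: (split_ordP i) => j ->; rewrite ?rowKu // rowKd row_id.
Qed.

Lemma row_free_extend (r : nat) (B : 'M[int]_(r, n)) v :
  row_free (rat_mx B) -> ~~ (rat_mx v <= rat_mx B)%MS ->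
  row_free (rat_mx (col_mx B v)).
Proof.
move=> freeB nvB; have lt : (\rank (rat_mx B) < \rank (rat_mx (col_mx B v)))%N.
  rewrite map_col_mx -addsmxE ltn_neqAle mxrankS ?addsmxSl // andbT.
  by rewrite (mxrank_leqif_sup (addsmxSl _ _)) addsmx_sub submx_refl.
rewrite /row_free; have := rank_leq_row (rat_mx (col_mx B v)); move: lt.
by rewrite (eqP freeB); lia.
Qed.

(** A largest independent family spans, since an element outside its span would extend it. It is a
    basis of the Q-span of [L], in general not of [L] over the integers. *)
Lemma lattice_basis L : exists B : 'M[int]_(lattice_rank L, n),
  [/\ forall i, L (row i B), row_free (rat_mx B) &
      forall v, L v -> (rat_mx v <= rat_mx B)%MS].
Proof.
have [B [LB freeB]] : exists B : 'M[int]_(lattice_rank L, n),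
    (forall i, L (row i B)) /\ row_free (rat_mx B).
  have [|i] := @eq_bigmax_cond 'I_n.+1 (fun r => `[< exists M : 'M[int]_(r, n),
    (forall i, L (row i M)) /\ row_free (rat_mx M) >]) (fun i : 'I_n.+1 => i : nat).
    (* The matrix without rows shows that the maximum is taken over a nonempty range, hence
       attained. *)
    apply/card_gt0P; exists ord0; apply/asboolP; exists (0 : 'M_(0, n)).
    by split=> [[]//|]; rewrite /row_free map_mx0 mxrank0.
  by rewrite /lattice_rank => /asboolP [M MP] ->; exists M.
exists B; split=> // v Lv; apply: contrapT => /negP nvB.
have := row_free_lattice_rank (lattice_rows_extend LB Lv) (row_free_extend freeB nvB).
by rewrite addn1 ltnn.
Qed.

Lemma SatP L (B : 'M[int]_(lattice_rank L, n)) :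
  (forall i, L (row i B)) -> (forall v, L v -> (rat_mx v <= rat_mx B)%MS) ->
  forall s, Sat D L s <-> Zpow D s /\ (rat_mx s <= rat_mx B)%MS.
Proof.
move=> LB spanB s; split=> [[Ds [r [M [LM sM]]]]|[Ds sB]]; last first.
  by split=> //; exists (lattice_rank L), B.
split=> //; apply: submx_trans sM _; apply/row_subP => i.
by rewrite -map_row; apply: spanB.
Qed.

Lemma sub_Sat L : lattice D L -> L `<=` Sat D L.
Proof.
move=> latL s Ls; split; first exact: (sub_Zpow latL).
by exists 1%N, s; split=> // i; rewrite row_id.
Qed.

Lemma Sat_lattice L : lattice D (Sat D L).
Proof.
have [B [LB _ spanB]] := lattice_basis L; have satP := SatP LB spanB.
split; last by move=> s [].
split; first by rewrite inE; apply/satP; rewrite map_mx0 sub0mx; split=> // i _; rewrite mxE.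
move=> s t; rewrite !inE => /satP[Ds sB] /satP[Dt tB]; apply/satP; split.
  by move=> i iD; rewrite !mxE Ds // Dt // subrr.
by rewrite map_mxB addmx_sub // eqmx_opp.
Qed.

(** The product of the denominators of a rational combination turns it into an integral one. *)
Lemma Sat_multiple L s : lattice D L -> Sat D L s -> exists2 N, (0 < N)%N & L (s *+ N).
Proof.
move=> latL [_ [r [M [LM /submxP[c sE]]]]].
pose N := (\prod_(i < r) `|denq (c 0%R i)|)%N.
have N0 : (0 < N)%N by apply: prodn_gt0 => i; rewrite absz_gt0 denq_neq0.
exists N => //.
have /choice[z zE] : forall i, exists z : int, c 0 i *+ N = z%:~R.
  move=> i; rewrite /N (bigD1 i) //=; set N' := \prod_(_ < r | _) _.
  exists (numq (c 0 i) *+ N'); rewrite mulrnA rmorphMn /=; congr (_ *+ _).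
  by rewrite numqE -mulr_natr natr_absz (gtr0_norm (denq_gt0 _)).
have -> : s *+ N = \sum_i row i M *~ z i.
  apply/rowP => j; apply: (intr_inj (R := rat)).
  have /rowP/(_ j) := sE; rewrite !mxE => sj.
  rewrite mulmxnE rmorphMn /= sj -sumrMnl summxE rmorph_sum; apply: eq_bigr => i _.
  by rewrite -mulrnAl zE mxE -scaler_int !mxE rmorphM /= intz.
by apply: (lattice_sum latL) => i; apply: (lattice_mulz latL).
Qed.

Lemma lattice_rank_lt L L' s : L `<=` L' -> Zpow D s -> L' s -> ~ Sat D L s ->
  (lattice_rank L < lattice_rank L')%N.
Proof.
move=> LL' Ds L's nSs; have [B [LB freeB spanB]] := lattice_basis L.
rewrite -addn1; apply: (row_free_lattice_rank (M := col_mx B s)).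
  by apply: lattice_rows_extend => // i; apply: LL'.
apply: row_free_extend => //; apply/negP => sB; apply: nSs.
exact/(SatP LB spanB).
Qed.

Lemma lattice_rank_witness L L' : lattice D L' ->
  (lattice_rank L < lattice_rank L')%N -> exists2 s, L' s & ~ Sat D L s.
Proof.
move=> latL' ltLL'; apply: contrapT => nwit.
have [B [LB freeB spanB]] := lattice_basis L.
have [B' [LB' freeB' _]] := lattice_basis L'.
move: ltLL'; rewrite ltnNge -(eqP freeB) -{1}(eqP freeB') => /negP; apply.
apply: mxrankS; apply/row_subP => i; rewrite -map_row.
have [] // := (SatP LB spanB (row i B')).1 _.
by apply: contrapT => nS; apply: nwit; exists (row i B').
Qed.

(* Evaluating a coordinate vector modulo the Q-span of [L], read as a
   polynomial, at an integer that is no root of finitely many of them. *)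
Lemma separating_form L (ws : seq 'rV[int]_n) : exists l : 'rV[int]_n -> rat,
  [/\ forall s t, l (s + t) = l s + l t, forall s, Sat D L s -> l s = 0 &
      forall w, w \in ws -> Zpow D w -> l w = 0 -> Sat D L w].
Proof.
have [B [LB _ spanB]] := lattice_basis L; have satP := SatP LB spanB.
pose p s : {poly rat} := rVpoly (rat_mx s *m cokermx (rat_mx B)).
have p0 s : (p s == 0) = (rat_mx s <= rat_mx B)%MS.
  by rewrite submxE /p raddf_eq0 //; exact: can_inj rVpolyK.
pose q := \prod_(w <- ws | p w != 0) p w.
have q0 : q != 0 by rewrite prodf_seq_neq0; apply/allP => w _; apply/implyP.
have [N qN] : exists N : nat, ~~ root q N%:R.
  apply: contrapT => nN; have := max_poly_roots q0 (rs := [seq i%:R | i <- iota 0 (size q)]).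
  rewrite size_map size_iota ltnn => H; apply: notF; apply: H.
    apply/allP => _ /mapP[i _ ->]; apply: contrapT => /negP Hi; apply: nN.
    by exists i.
  rewrite map_inj_uniq ?iota_uniq // => i j /eqP; rewrite eqr_nat => /eqP //.
exists (fun s => (p s).[N%:R]); split.
- by move=> s t; rewrite /p map_mxD mulmxDl linearD hornerD.
- by move=> s /satP[_]; rewrite -p0 => /eqP ps0 /=; rewrite ps0 horner0.
move=> w ww Dw pw; apply/satP; split=> //; rewrite -p0.
apply: contraNT qN => pw0; apply/rootP; rewrite /q (big_rem w) //= pw0.
by rewrite hornerM pw mul0r.
Qed.

End Saturation.
(** * Nonzerodivisors modulo binomial ideals *)

Lemma seq_argmax (T : eqType) (F : T -> rat) (A : T -> Prop) (s : seq T) x0 :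
  x0 \in s -> A x0 ->
  exists x, [/\ x \in s, A x & forall y, y \in s -> A y -> F y <= F x].
Proof.
elim: s x0 => // x s IHs x0 x0s Ax0.
have [[y ys Ay]|ns] := pselect (exists2 y, y \in s & A y); last first.
  exists x0; split=> // y; rewrite inE => /orP[/eqP ->|ys] Ay; last by case: ns; exists y.
  move: x0s; rewrite inE => /orP[/eqP ->//|x0s].
  by case: ns; exists x0.
have [z [zs Az maxz]] := IHs _ ys Ay.
have [[Ax ltzx]|nx] := pselect (A x /\ F z < F x).
  exists x; split=> //; first by rewrite inE eqxx.
  move=> t; rewrite inE => /orP[/eqP ->//|ts At].
  exact: le_trans (maxz _ ts At) (ltW ltzx).
exists z; split=> //; first by rewrite inE zs orbT.
move=> t; rewrite inE => /orP[/eqP ->|/maxz//] Ax.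
by rewrite leNgt; apply/negP => ltzx; apply: nx.
Qed.

Section Regular.
Variables (n : nat) (k : closedFieldType) (D : {set 'I_n}) (L : set 'rV[int]_n).
Implicit Types (f g h b : {mpoly k[n]}) (u v w : 'X_{1..n}) (J P : set {mpoly k[n]}).

Lemma msupp_eliminate f b u : u \in msupp f -> b@_u = 1 ->
  {subset msupp b <= msupp f} -> (size (msupp (f - f@_u *: b)) < size (msupp f))%N.
Proof.
move=> uf bu sub; apply: (@leq_trans (size (u :: msupp (f - f@_u *: b)))) => //.
apply: uniq_leq_size => [|m].
  by rewrite /= msupp_uniq andbT mcoeff_msupp mcoeffB mcoeffZ bu mulr1 subrr eqxx.
rewrite inE => /orP[/eqP ->//|/msuppB_le].
by rewrite mem_cat => /orP[//|/msuppZ_le/sub].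
Qed.

Lemma msupp_eliminate_monomial f u : u \in msupp f ->
  (size (msupp (f - f@_u *: 'X_[u])) < size (msupp f))%N.
Proof.
move=> uf; apply: msupp_eliminate => //; first by rewrite mcoeffX eqxx.
by move=> m; rewrite msuppX inE => /eqP ->.
Qed.

Lemma msupp_eliminate_binomial f c u v : u \in msupp f -> v \in msupp f -> u != v ->
  (size (msupp (f - f@_u *: ('X_[u] - c *: 'X_[v]))) < size (msupp f))%N.
Proof.
move=> uf vf uv; apply: msupp_eliminate => //.
  by rewrite mcoeffB mcoeffZ !mcoeffX eqxx eq_sym (negPf uv) mulr0 subr0.
move=> m /msuppB_le; rewrite mem_cat msuppX inE => /orP[/eqP ->//|/msuppZ_le].
by rewrite msuppX inE => /eqP ->.
Qed.

Definition separated h : Prop :=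
  [/\ h != 0, polysub D h & forall v w, v \in msupp h -> w \in msupp h ->
        Sat D L (mnm_diff v w) -> v = w].

(** Induction on the number of terms: modulo [P], terms not over N^D are dropped, and one of two
    terms congruent modulo [Sat L] is replaced by a multiple of the other. *)
Lemma separated_representative P f : is_ideal P ->
  (forall u, ~ Npow D u -> P 'X_[u]) ->
  (forall u v, Npow D u -> Npow D v -> Sat D L (mnm_diff u v) ->
     exists c, P ('X_[u] - c *: 'X_[v])) ->
  ~ P f -> exists2 h, separated h & P (f - h).
Proof.
move=> idP Pmon Pbin; have [N] := ubnP (size (msupp f)).
elim: N f => // N IHN f; rewrite ltnS => leN Pf.
have step g : P g -> (size (msupp (f - g)) < size (msupp f))%N ->
    exists2 h, separated h & P (f - h).
  move=> Pg lt.
  have [|h sh Ph] := IHN (f - g) (leq_trans lt leN).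
    by move=> Pfg; apply: Pf; apply: idealBr Pfg Pg.
  by exists h => //; rewrite -(subrK g f) addrAC; apply: idealD.
have [[u uf nDu]|Df] := pselect (exists2 u, u \in msupp f & ~ Npow D u).
  apply: (step (f@_u *: 'X_[u])); first by apply: idealZ => //; apply: Pmon.
  exact: msupp_eliminate_monomial.
have {}Df : polysub D f.
  by move=> u uf; apply: contrapT => nDu; apply: Df; exists u.
have [[u [v [uf vf uv Suv]]]|nS] := pselect (exists u v,
    [/\ u \in msupp f, v \in msupp f, u != v & Sat D L (mnm_diff u v)]).
  have [c Pc] := Pbin u v (Df _ uf) (Df _ vf) Suv.
  apply: (step (f@_u *: ('X_[u] - c *: 'X_[v]))); first exact: idealZ.
  exact: msupp_eliminate_binomial.
exists f; last by rewrite subrr; apply: ideal0.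
split=> //; first by apply/eqP => f0; apply: Pf; rewrite f0; apply: ideal0.
move=> u v uf vf Suv; apply: contrapT => /eqP uv; apply: nS.
by exists u, v.
Qed.

(** Induction on the number of terms of [f]. Once no term is in [J] and no two are congruent, a
    linear form vanishing on [Sat L] and separating the terms of [h] grades the orbit of one term of
    [f]. The product of top terms is congruent to no other product, which contradicts exchange in
    [h * f]. *)
Lemma separated_regular J h : is_ideal J -> binomial_exchange J ->
  (forall w u, Npow D w -> J 'X_[w + u] -> J 'X_[u]) ->
  (forall w u v c, Npow D w -> c != 0 -> J ('X_[w + u] - c *: 'X_[w + v]) ->
     J ('X_[u] - c *: 'X_[v])) ->
  (forall u w w' c, Npow D w -> Npow D w' -> c != 0 -> ~ J 'X_[u] ->
     J ('X_[w + u] - c *: 'X_[w' + u]) -> Sat D L (mnm_diff w w')) ->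
  separated h -> forall f, J (h * f) -> J f.
Proof.
move=> idJ exchJ monJ binJ latJ [h0 Dh sep] f.
have [N] := ubnP (size (msupp f)); elim: N f => // N IHN f; rewrite ltnS => leN Jhf.
have step g : J g -> (size (msupp (f - g)) < size (msupp f))%N -> J f.
  move=> Jg lt; apply: (idealBr idJ _ Jg); apply: (IHN _ (leq_trans lt leN)).
  by rewrite mulrBr; apply: idealB => //; apply: idealMl.
have [[u uf Ju]|nJ] := pselect (exists2 u, u \in msupp f & J 'X_[u]).
  apply: (step (f@_u *: 'X_[u])); first exact: idealZ.
  exact: msupp_eliminate_monomial.
have {}nJ u : u \in msupp f -> ~ J 'X_[u] by move=> uf Ju; apply: nJ; exists u.
have [[u [v [c [uf vf uv Jc]]]]|nb] := pselect (exists u v c,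
    [/\ u \in msupp f, v \in msupp f, u != v & J ('X_[u] - c *: 'X_[v])]).
  apply: (step (f@_u *: ('X_[u] - c *: 'X_[v]))); first exact: idealZ.
  exact: msupp_eliminate_binomial.
have {}nb u v c : u \in msupp f -> v \in msupp f -> J ('X_[u] - c *: 'X_[v]) -> u = v.
  by move=> uf vf Jc; apply: contrapT => /eqP uv; apply: nb; exists u, v, c.
have [->|f0] := eqVneq f 0; first exact: ideal0.
have [u0 u0f] : exists u, u \in msupp f by exists (mlead f); apply: mlead_supp.
have [l [lD lS lsep]] := separating_form D L
  [seq mnm_diff v w | v <- msupp h, w <- msupp h].
have l0 : l 0 = 0 by have := lD 0 0; rewrite addr0; lra.
have lN s : l (- s) = - l s by have := lD s (- s); rewrite subrr l0; lra.
(* Up to monomials over N^D, [u] is [u0] shifted by [w' - w]. *)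
pose linked u w w' := exists c, [/\ Npow D w, Npow D w', c != 0 &
  J ('X_[w + u] - c *: 'X_[w' + u0])].
(* The degree of [u] in the orbit of [u0] under multiplication by monomials
   over N^D; it is well defined since [l] vanishes on the saturation. *)
have /choice[d dP] : forall u, exists d, forall w w', linked u w w' -> d = l (mnm_diff w' w).
  move=> u; have [[w [w' [c [Dw Dw' c0 Jc]]]]|nl] :=
    pselect (exists w w', linked u w w'); last first.
    by exists 0 => w w' lw; case: nl; exists w, w'.
  exists (l (mnm_diff w' w)) => v v' [e [Dv Dv' e0 Je]].
  have Jc' := ideal_congrD idJ v Jc; have Je' := ideal_congrD idJ w Je.
  have := latJ u0 (v + w')%MM (w + v')%MM (c^-1 * e).
  rewrite -!addmA; case.
  - exact/NpowD.
  - exact/NpowD.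
  - by rewrite mulf_neq0 ?invr_eq0.
  - exact: nJ.
  - apply: ideal_congr_trans (ideal_congr_sym idJ c0 Jc') _ => //.
    by rewrite addmA (addmC v w) -addmA.
  move=> Dd Ee; have /lS : Sat D L (mnm_diff (v + w')%MM (w + v')%MM) by split.
  rewrite addmC mnm_diffD -(mnm_diffN v' v) lD lN; lra.
have linked0 : linked u0 0%MM 0%MM.
  exists 1; rewrite oner_neq0; split=> //; [exact: Npow0|exact: Npow0|].
  exact: ideal_congr_refl.
have [u [uf [a [b [c [Da Db c0 Jc]]]] maxu]] := seq_argmax d
  (A := fun u => exists w w', linked u w w') u0f (ex_intro _ _ (ex_intro _ _ linked0)).
have hl : mlead h \in msupp h by apply: mlead_supp.
have [wm [wmh _ maxw]] := seq_argmax (fun w => l (mnm_diff w 0%MM))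
  (A := fun=> True) hl Logic.I.
(* Such a [v] is in the orbit of [u0], of degree [d u + l (wm - w)]. Maximality of [u] and of [wm]
   makes the second summand 0, so [w = wm] by separation, and then [v] is congruent to [u]. *)
have isolated w v e : w \in msupp h -> v \in msupp f -> e != 0 ->
    J ('X_[wm + u] - e *: 'X_[w + v]) -> w = wm /\ v = u.
  move=> wh vf e0 Je.
  have lv : linked v (a + w)%MM (wm + b)%MM.
    exists (e^-1 * c); split; rewrite ?mulf_neq0 ?invr_eq0 //.
    - by apply/NpowD; split=> //; apply: Dh.
    - by apply/NpowD; split=> //; apply: Dh.
    have := ideal_congrD idJ a (ideal_congr_sym idJ e0 Je); rewrite addmA => H.
    apply: ideal_congr_trans H _ => //.
    by rewrite addmA (addmC a) -!addmA; apply: ideal_congrD.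
  have := maxu v vf (ex_intro _ _ (ex_intro _ _ lv)).
  have -> : d u = l (mnm_diff b a) by apply: dP; exists c.
  rewrite (dP _ _ _ lv) (addmC a) mnm_diffD lD => leu.
  have := maxw w wh Logic.I.
  rewrite -(mnm_diff_trans w wm) lD => lew.
  have wmw : wm = w.
    apply: sep => //; apply: lsep.
    - by apply/allpairsP; exists (wm, w).
    - by apply: Npow_mdiff; apply: Dh.
    - lra.
  split=> //; rewrite -wmw in Je; apply/esym; apply: (nb _ _ e) => //.
  by apply: binJ Je => //; apply: Dh.
(* An equality of exponents is a congruence with scalar 1, so isolation leaves a single
   contribution. *)
have hfm : (h * f)@_(wm + u) = h@_wm * f@_u.
  rewrite [h in LHS]mpolyE [f in LHS]mpolyE mulr_suml raddf_sum /=.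
  rewrite (bigD1_seq wm) ?msupp_uniq //= [X in _ + X]big_seq_cond [X in _ + X]big1 ?addr0.
    rewrite mulr_sumr raddf_sum (bigD1_seq u) ?msupp_uniq //=.
    rewrite [X in _ + X]big_seq_cond [X in _ + X]big1 ?addr0.
      by rewrite -scalerAl -scalerAr -mpolyXD scalerA mcoeffZ mcoeffX eqxx mulr1.
    move=> v /andP[vf vu]; rewrite -scalerAl -scalerAr -mpolyXD !mcoeffZ mcoeffX.
    by rewrite eqm_add2l (negPf vu) !mulr0.
  move=> w /andP[wh wwm]; rewrite mulr_sumr raddf_sum big_seq_cond big1 //= => v.
  rewrite andbT => vf; rewrite -scalerAl -scalerAr -mpolyXD !mcoeffZ mcoeffX.
  case: eqP => [E|_]; last by rewrite !mulr0.
  have [] := isolated w v 1 wh vf (oner_neq0 _); last by move=> E'; rewrite E' eqxx in wwm.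
  by rewrite E; apply: ideal_congr_refl.
have mhf : (wm + u)%MM \in msupp (h * f).
  by rewrite mcoeff_msupp hfm mulf_neq0 // -mcoeff_msupp.
(* The top monomial is not in [J], and a partner for it would be another product of terms, excluded
   by isolation. *)
have [Jm|[m [e [mm nm e0 Je]]]] := exchJ _ _ Jhf mhf.
  by case: (nJ u uf); apply: monJ Jm; apply: Dh.
have /allpairsP[[w v] /= [wh vf mE]] := msuppM_le mm; rewrite mE in Je nm.
by have [ww vu] := isolated w v e wh vf e0 Je; rewrite ww vu eqxx in nm.
Qed.

End Regular.
(** * Cellular binomial ideals *)

Section Saturated.
Variables (n : nat) (k : closedFieldType) (D : {set 'I_n}).
Implicit Types (f g : {mpoly k[n]}) (u v w : 'X_{1..n}) (I J Q : set {mpoly k[n]}).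

Lemma saturated_variables J :
  (forall i, i \in D -> forall f, J ('X_i * f) -> J f) -> saturated D J.
Proof.
move=> JX w f Dw; rewrite mpolyXE_id; elim: (index_enum _) f => [|i s IHs] f.
  by rewrite big_nil mul1r.
rewrite big_cons -mulrA => Jf; apply: IHs.
case: (boolP (i \in D)) => [iD|/Dw wi]; last by move: Jf; rewrite wi expr0 mul1r.
elim: (w i) Jf => [|N IHN]; first by rewrite expr0 mul1r.
by rewrite exprS -mulrA => /(JX i iD).
Qed.

Lemma saturated_binomial J c u v w : saturated D J -> Npow D w ->
  J ('X_[w + u] - c *: 'X_[w + v]) -> J ('X_[u] - c *: 'X_[v]).
Proof. by move=> satJ Dw Jc; apply: (satJ w) => //; rewrite mulrBr -scalerAr -!mpolyXD. Qed.

Lemma saturated_monomialM J u w : saturated D J -> Npow D w -> J 'X_[w + u] -> J 'X_[u].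
Proof. by move=> satJ Dw; rewrite mpolyXD; apply: satJ. Qed.

Lemma mem_msuppX w u f : ((w + u)%MM \in msupp ('X_[w] * f)) = (u \in msupp f).
Proof. by rewrite !mcoeff_msupp mulrC mcoeffMX. Qed.

Lemma msuppXP w m f : m \in msupp ('X_[w] * f) ->
  exists2 u, u \in msupp f & m = (w + u)%MM.
Proof.
move=> /msuppM_le/allpairsP[[w' u] /= [+ uf ->]].
by rewrite msuppX inE => /eqP ->; exists u.
Qed.

(* Exchange passes to any ideal of the form [J : x^w], possibly with [w] depending
   on the element. *)
Lemma exchange_colon J Q : binomial_exchange J ->
  (forall f, Q f -> exists w, J ('X_[w] * f) /\ forall g, J ('X_[w] * g) -> Q g) ->
  binomial_exchange Q.
Proof.
move=> exchJ QJ f u /QJ [w [Jf JQ]] uf.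
have [|Ju|[m [c [mf mu c0 Jc]]]] := exchJ _ (w + u)%MM Jf; first by rewrite mem_msuppX.
  by left; apply: JQ; rewrite -mpolyXD.
case/msuppXP: mf => v vf mE; rewrite mE in mu Jc.
right; exists v, c; split=> //; first by apply: contraNneq mu => ->.
by apply: JQ; rewrite mulrBr -scalerAr -!mpolyXD.
Qed.

Lemma lattice_ideal_add (L : set 'rV[int]_n) (rho : 'rV[int]_n -> k) f c u v :
  Npow D u -> Npow D v -> L (mnm_diff u v) -> lattice_ideal D L rho f ->
  lattice_ideal D L rho (f + c *: ('X_[u] - rho (mnm_diff u v) *: 'X_[v])).
Proof.
move=> Du Dv Luv [r [a [s [Da Ss ->]]]].
exists r.+1, (fun i => if unlift ord0 i is Some j then a j else c%:MP).
exists (fun i => if unlift ord0 i is Some j then s j else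
  'X_[u] - rho (mnm_diff u v) *: 'X_[v]); split=> [i|i|].
- case: unliftP => [j _|_]; first exact: Da.
  move=> m /=; rewrite msuppC; case: ifP => // _.
  by rewrite inE => /eqP ->; apply: Npow0.
- by case: unliftP => [j _|_]; [apply: Ss | exists u, v].
rewrite big_ord_recl unlift_none mul_mpolyC addrC; congr (_ + _).
by apply: eq_bigr => i _; rewrite liftK.
Qed.

(** A member of [Q] over N^D has no term in [Q], by saturation. Exchange therefore matches its
    leading monomial with another term, and subtracting a multiple of the resulting binomial of the
    character shortens it. *)
Lemma saturated_has_character Q : is_ideal Q -> ~ Q 1 -> saturated D Q ->
  binomial_exchange Q ->
  exists chi, has_character D Q (ideal_lattice D Q) chi /\
    forall s, ideal_lattice D Q s -> ideal_ratio D Q s (chi s).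
Proof.
move=> idQ Q1 satQ exchQ.
have [chi [chiP ratioP]] := saturated_character idQ Q1 satQ.
exists chi; split=> //; split=> //; apply/seteqP; split; last first.
  move=> f lf; split; last exact: lattice_ideal_polysub lf.
  apply: (sub_lattice_ideal idQ); last by apply: sub_ideal_gen; exact: lf.
  move=> u v Du Dv Luv; apply: ideal_ratio_binomial (ratioP _ Luv) => //.
move=> f [Qf Df]; have [N] := ubnP (size (msupp f)).
elim: N f Qf Df => // N IHN f Qf Df; rewrite ltnS => leN.
have [->|f0] := eqVneq f 0.
  by exists 0%N, (fun=> 0), (fun=> 0); split=> [[]|[]|] //; rewrite big_ord0.
have uf := mlead_supp f0; set u := mlead f in uf.
have [Qu|[v [c [vf vu c0 Qc]]]] := exchQ f u Qf uf.
  by case: (saturated_monomial Q1 satQ (Df _ uf) Qu).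
have Quv : ideal_ratio D Q (mnm_diff u v) c by exists u, v; split=> //; apply: Df.
have Luv : ideal_lattice D Q (mnm_diff u v) by exists c.
have cE := ideal_ratio_uniq idQ Q1 satQ Quv (ratioP _ Luv).
pose f' := f - f@_u *: ('X_[u] - c *: 'X_[v]).
suff lf' : lattice_ideal D (ideal_lattice D Q) chi f'.
  have := lattice_ideal_add (f@_u) (Df _ uf) (Df _ vf) Luv lf'.
  by rewrite -cE subrK.
apply: IHN.
- by apply: idealB => //; apply: idealZ.
- move=> m /msuppB_le; rewrite mem_cat => /orP[/Df//|/msuppZ_le/msuppB_le].
  rewrite mem_cat msuppX inE => /orP[/eqP ->|/msuppZ_le]; first exact: Df.
  by rewrite msuppX inE => /eqP ->; apply: Df.
by apply: leq_trans leN; apply: msupp_eliminate_binomial; rewrite // eq_sym.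
Qed.

(** The class forms of [rho'] kill the binomial of [rho] at [s], which forces both membership in
    [L'] and the value. *)
Lemma lattice_ideal_inj (L L' : set 'rV[int]_n) (rho rho' : 'rV[int]_n -> k) s :
  partial_character D L rho -> partial_character D L' rho' ->
  lattice_ideal D L rho `<=` ideal_gen (lattice_ideal D L' rho') ->
  L s -> L' s /\ rho s = rho' s.
Proof.
move=> rhoP rhoP' sub Ls.
have [u [v [Du Dv sE]]] := Zpow_mnm_diff (sub_Zpow (character_lattice rhoP) Ls).
rewrite sE in Ls *.
have /sub/(class_form_lattice_ideal rhoP' u) := lattice_binomial_ideal rho Du Dv Ls.
by case/(class_form_congr rhoP' Du).
Qed.

(** Every monomial over N^D divides a power of the product of the variables in [D], and these powers
    are such monomials themselves. *)
Lemma colon_infty_monomial J f : is_ideal J ->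
  colon_infty J (\prod_(i in D) 'X_i) f <-> exists2 w, Npow D w & J ('X_[w] * f).
Proof.
move=> idJ; pose d := (\sum_(i in D) U_(i) : 'X_{1..n})%MM.
have dE i : d i = (i \in D).
  rewrite /d mnm_sumE; under eq_bigr => j _ do rewrite mnm1E.
  rewrite -big_mkcondr /=.
  case: (boolP (i \in D)) => iD; last first.
    by rewrite big1 // => j /andP[jD /eqP ij]; rewrite -ij jD in iD.
  rewrite (bigD1 i) ?iD ?eqxx //= big1 // => j /andP[/andP[_ /eqP ->]].
  by rewrite eqxx.
have -> : \prod_(i in D) 'X_i = 'X_[d] :> {mpoly k[n]} by rewrite mprodXE.
rewrite /colon_infty /=; split=> [[N]|[w Dw Jf]].
  rewrite mpolyXn mulrC; exists (d *+ N)%MM => //; apply: NpowMn => i.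
  by rewrite dE => /negPf ->.
(* The total degree bounds every exponent of [w]. *)
exists (mdeg w); rewrite mpolyXn mulrC.
have wd : (w <= d *+ mdeg w)%MM.
  apply/mnm_lepP => i; rewrite mulmnE dE; case: (boolP (i \in D)) => [_|/Dw ->//].
  by rewrite mul1n mdegE (bigD1 i) //= leq_addr.
by rewrite -(submK wd) mpolyXD -mulrA; apply: idealMl.
Qed.

Lemma ideal_add_gen (S S' : set {mpoly k[n]}) :
  ideal_add (ideal_gen S) (ideal_gen S') = ideal_gen (S `|` S').
Proof.
apply/seteqP; split.
  apply: ideal_add_sub; first exact: ideal_gen_ideal.
    by apply: ideal_gen_sub; [exact: ideal_gen_ideal | move=> f Sf; apply: sub_ideal_gen; left].
  by apply: ideal_gen_sub; [exact: ideal_gen_ideal | move=> f Sf; apply: sub_ideal_gen; right].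
apply: ideal_gen_sub => [|f [Sf|Sf]].
- by apply: ideal_add_ideal; apply: ideal_gen_ideal.
- by apply: sub_ideal_addl; [exact: (ideal0 (ideal_gen_ideal _)) | apply: sub_ideal_gen].
by apply: sub_ideal_addr; [exact: (ideal0 (ideal_gen_ideal _)) | apply: sub_ideal_gen].
Qed.

End Saturated.

Section CellularBinomialIdeal.
Variables (n : nat) (k : closedFieldType) (D : {set 'I_n}) (I : set {mpoly k[n]}).
Variables (L : set 'rV[int]_n) (rho : 'rV[int]_n -> k).
Hypotheses (binI : binomial_ideal I) (cellI : cellular D I).
Hypothesis charI : has_character D I L rho.
Implicit Types (f g : {mpoly k[n]}) (u v w m : 'X_{1..n}).

Lemma cellular_ideal : is_ideal I.
Proof. by case: cellI => /idealr_closedP[]. Qed.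

Lemma cellular_proper : ~ I 1.
Proof. by case: cellI => /idealr_closedP[]. Qed.

Lemma cellular_saturated : saturated D I.
Proof. by case: cellI => _ IX _; apply: saturated_variables. Qed.

Lemma cellular_exchange : binomial_exchange I.
Proof. by case: binI => B [B2 ->]; apply: binomial_ideal_exchange. Qed.

Lemma cellular_lattice_ideal : lattice_ideal D L rho `<=` I.
Proof. by move=> f lf; case: charI => _ E; move: lf; rewrite -E => -[]. Qed.

Lemma character_unique L0 rho0 : has_character D I L0 rho0 -> L0 = L.
Proof.
case: charI => rhoP E [rhoP0 E0].
have sub : lattice_ideal D L0 rho0 `<=` ideal_gen (lattice_ideal D L rho).
  by rewrite -E0 E; apply: sub_ideal_gen.
have sub' : lattice_ideal D L rho `<=` ideal_gen (lattice_ideal D L0 rho0).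
  by rewrite -E E0; apply: sub_ideal_gen.
apply/seteqP; split=> s Ls.
  by case: (lattice_ideal_inj rhoP0 rhoP sub Ls).
by case: (lattice_ideal_inj rhoP rhoP0 sub' Ls).
Qed.

(* [x^u] is congruent mod [I] to [c x^(u + s)] for some [s] outside [Sat L]: up to
   members of [I], these are the monomials of [M_emb I]. *)
Definition escaping u : Prop := exists w w' c, [/\ Npow D w, Npow D w', c != 0,
  I ('X_[w + u] - c *: 'X_[w' + u]) & ~ Sat D L (mnm_diff w w')].

Lemma escapingD u v : escaping u -> escaping (v + u).
Proof.
move=> [w [w' [c [Dw Dw' c0 Ic nS]]]]; exists w, w', c; split=> //.
rewrite !(addmC v) !addmA ![(_ + v)%MM]addmC.
exact: (ideal_congrD cellular_ideal).
Qed.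

Lemma escapingI u w : Npow D w -> escaping (w + u) -> escaping u.
Proof.
move=> Dw [v [v' [c [Dv Dv' c0 Ic nS]]]]; exists v, v', c; split=> //.
apply: (saturated_binomial (w := w) cellular_saturated) => //.
by rewrite !addmA !(addmC w) -!addmA.
Qed.

Lemma escaping_congr c u v : c != 0 -> I ('X_[u] - c *: 'X_[v]) ->
  escaping u -> escaping v.
Proof.
have idI := cellular_ideal.
move=> c0 Ic [w [w' [d [Dw Dw' d0 Id nS]]]].
exists w, w', (c^-1 * (d * c)); split; rewrite ?mulf_neq0 ?invr_eq0 //.
apply: (ideal_congr_trans idI (ideal_congrD idI w (ideal_congr_sym idI c0 Ic))).
by apply: (ideal_congr_trans idI Id); apply: ideal_congrD.
Qed.

(** The part [a] of [u] outside [D] is itself a witness monomial: [I : x^a] is proper, saturated and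
    has the exchange property, so it has a character. Its lattice contains [L] and an element
    outside [Sat L], hence has larger rank. *)
Lemma escaping_M_emb u : escaping u -> ~ I 'X_[u] -> M_emb D I 'X_[u].
Proof.
have [idI satI] := (cellular_ideal, cellular_saturated).
have [a [w0 [Da Dw0 ->]]] := mnm_split D u; rewrite addmC => Eu nIu.
case: (escapingI Dw0 Eu) => w [w' [c [Dw Dw' c0 Ic nS]]].
rewrite mpolyXD in nIu *; apply: idealMl; first exact: ideal_gen_ideal.
have Ia : ~ I 'X_[a] by move=> Ia; apply: nIu; apply: idealMl.
pose Q := colon I 'X_[a].
have idQ : is_ideal Q by apply: colon_ideal.
have Q1 : ~ Q 1 by rewrite /Q /colon /= mul1r.
have satQ : saturated D Q.
  by move=> v f Dv; rewrite /Q /colon /= -mulrA; apply: satI.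
have exchQ : binomial_exchange Q.
  apply: (exchange_colon cellular_exchange) => f Qf; exists a.
  by split=> [|g]; rewrite /Q /colon /= mulrC.
have [tau [tauP ratioP]] := saturated_has_character idQ Q1 satQ exchQ.
have Qs : ideal_lattice D Q (mnm_diff w w').
  exists c, w, w'; split=> //.
  by rewrite /Q /colon /= mulrBl -scalerAl -!mpolyXD.
apply: sub_ideal_gen; exists (ideal_lattice D Q), a.
have wit : witness_monomial D I (ideal_lattice D Q) a by split=> //; exists tau.
split=> //; split; first by exists a.
exists L, rho; split=> //; apply: lattice_rank_lt nS => //; last exact: Npow_mdiff.
case: charI => rhoP _ s Ls.
have [v [v' [Dv Dv' sE]]] := Zpow_mnm_diff (sub_Zpow (character_lattice rhoP) Ls).
exists (rho s), v, v'; split=> //; apply: sub_colon => //; apply: cellular_lattice_ideal.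
by rewrite sE in Ls *; apply: lattice_binomial_ideal.
Qed.

(** A lattice of larger rank contains an element outside [Sat L]; its binomial in [I : x^w] shows
    that the witness [w] escapes, and multiples of escaping monomials escape. *)
Lemma M_emb_escaping f m : M_emb D I f -> m \in msupp f -> escaping m.
Proof.
move=> Mf; move: f Mf m; apply: ideal_gen_ind => [m|a f g Ef Eg m|v f [L' [w [emb wit ->]]] m].
- by rewrite msupp0.
- by move=> /msuppD_le; rewrite mem_cat => /orP[/msuppZ_le/Ef|/Eg].
rewrite -mpolyXD msuppX inE => /eqP ->; apply: escapingD.
case: emb => _ [L0 [rho0 [/character_unique -> ltr]]].
case: wit => _ [tau [tauP E]].
have latL' := character_lattice tauP.
have [s L's nS] := lattice_rank_witness latL' ltr.
have [u [u' [Du Du' sE]]] := Zpow_mnm_diff (sub_Zpow latL' L's).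
rewrite sE in L's nS *; exists u, u', (tau (mnm_diff u u')); split=> //.
  exact: (character_neq0 tauP).
have : colon I 'X_[w] ('X_[u] - tau (mnm_diff u u') *: 'X_[u']).
  by have := lattice_binomial_ideal tau Du Du' L's; rewrite -E => -[].
by rewrite /colon /= mulrBl -scalerAl -!mpolyXD.
Qed.

(** * The proposed component, for a partial character on a lattice inside the saturation *)

Section Component.
Variables (T : set 'rV[int]_n) (sigma : 'rV[int]_n -> k).
Hypotheses (sigmaP : partial_character D T sigma) (TS : T `<=` Sat D L).

Let I' := ideal_add I (ideal_gen (lattice_ideal D T sigma)).
Let K := colon_infty I' (\prod_(i in D) 'X_i).
Let J := ideal_add K (M_emb D I).

Lemma sum_ideal : is_ideal I'.
Proof. by apply: ideal_add_ideal; [exact: cellular_ideal | exact: ideal_gen_ideal]. Qed.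

Lemma sub_sum : I `<=` I'.
Proof. by apply: sub_ideal_addl; exact: (ideal0 (ideal_gen_ideal _)). Qed.

Lemma sum_exchange : binomial_exchange I'.
Proof.
rewrite /I'; case: binI => B [B2 ->].
rewrite ideal_gen_lattice_ideal ideal_add_gen.
apply: binomial_ideal_exchange => s [/B2//|]; exact: size_lattice_binomial.
Qed.

(** The congruence of [I'] is generated by the moves of [I] and those along [T]; a set stable under
    both is a union of classes, so the projection preserves [I']. Invariants of a class are thus
    proved without chains of congruences. *)
Lemma restrict_sum (A : set 'X_{1..n}) :
  (forall u v c, c != 0 -> I ('X_[u] - c *: 'X_[v]) -> A u -> A v) ->
  (forall m u v, Npow D u -> Npow D v -> T (mnm_diff u v) -> A (m + u)%MM -> A (m + v)%MM) ->
  forall f, I' f -> I' (restrict A f).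
Proof.
move=> AI AT _ [f If [g Tg <-]]; have idI' := sum_ideal.
rewrite /restrict mlinD; apply: idealD => //.
  have idI := cellular_ideal.
  case: binI If => B [B2 IE]; rewrite {1}IE; move: f; apply: restrict_ideal_gen => // m s Bs.
  apply: sub_sum; apply: restrict_binomial => //; last by rewrite size_msuppMX B2.
  by apply: idealMl => //; rewrite IE; apply: sub_ideal_gen.
have latT := character_lattice sigmaP.
move: Tg; rewrite ideal_gen_lattice_ideal; move: g.
apply: restrict_ideal_gen => // m _ [u [v [Du Dv Tuv ->]]].
have Tvu : T (mnm_diff v u) by rewrite -mnm_diffN; apply: (latticeN latT).
have Ib : I' ('X_[m + u] - sigma (mnm_diff u v) *: 'X_[m + v]).
  apply: (ideal_congrD idI'); apply: sub_ideal_addr; first exact: ideal0 cellular_ideal.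
  by apply: sub_ideal_gen; apply: lattice_binomial_ideal.
rewrite mulrBr -scalerAr -!mpolyXD /restrict mlinB mlinZ !mlinX.
case: asboolP => [Au|nAu]; case: asboolP => [Av|nAv] //.
- by case: nAv; apply: AT Au.
- by case: nAu; apply: AT Av.
by rewrite scaler0 subr0; apply: ideal0.
Qed.

Lemma saturation_ideal : is_ideal K.
Proof. by apply: colon_infty_ideal; apply: sum_ideal. Qed.

Lemma saturationP f : K f <-> exists2 w, Npow D w & I' ('X_[w] * f).
Proof. exact: colon_infty_monomial sum_ideal. Qed.

Lemma saturation_binomial c u v : K ('X_[u] - c *: 'X_[v]) ->
  exists2 w, Npow D w & I' ('X_[w + u] - c *: 'X_[w + v]).
Proof.
by case/saturationP => w Dw; rewrite mulrBr -scalerAr -!mpolyXD; exists w.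
Qed.

Lemma saturation_saturated : saturated D K.
Proof.
move=> w f Dw /saturationP[v Dv I'f]; apply/saturationP; exists (v + w)%MM.
  exact/NpowD.
by rewrite mpolyXD -mulrA.
Qed.

Lemma saturation_exchange : binomial_exchange K.
Proof.
apply: (exchange_colon sum_exchange) => f /saturationP[w Dw I'f]; exists w.
by split=> // g I'g; apply/saturationP; exists w.
Qed.

Lemma sub_saturation : I' `<=` K.
Proof. exact: sub_colon_infty. Qed.

(** The monomials that escape or lie in [I] are stable under both kinds of moves. If the congruence
    leaves this set, projecting onto it puts both monomials into [I'], after multiplication by some
    [x^w]. *)
Lemma saturation_escaping c u v : c != 0 -> K ('X_[u] - c *: 'X_[v]) ->
  I 'X_[u] \/ escaping u -> K 'X_[v] \/ (I 'X_[v] \/ escaping v).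
Proof.
have [idI satI] := (cellular_ideal, cellular_saturated).
move=> c0 /saturation_binomial[w Dw I'c] Eu.
have [Ev|nEv] := pselect (I 'X_[w + v] \/ escaping (w + v)).
  right; case: Ev => [Iv|/(escapingI Dw)]; last by right.
  by left; apply: (saturated_monomialM satI Dw).
left; apply/saturationP; exists w => //; rewrite -mpolyXD.
apply: (ideal_congrX sum_ideal c0 I'c).
rewrite -(restrict_congr (B := fun m => I 'X_[m] \/ escaping m) c _ nEv); last first.
  case: Eu => [Iu|Eu]; last by right; apply: escapingD.
  by left; rewrite mpolyXD; apply: idealMl.
apply: restrict_sum I'c.
  move=> m m' d d0 Id [Im|Em]; first by left; apply: (ideal_congrX idI d0 Id).
  by right; apply: (escaping_congr d0 Id).
move=> m a b Da Db Tab [Im|Em].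
  left; rewrite mpolyXD; apply: idealMr => //.
  by apply: (saturated_monomialM satI Da); rewrite addmC.
right; rewrite addmC; apply: escapingD; apply: (escapingI Da).
by rewrite addmC.
Qed.

(** Let [A] consist of the monomials that [I] links to [u] with shift [t + w] modulo [Sat L]; it is
    stable under both kinds of moves, as [T] is inside [Sat L]. If the congruence leaves [A], then
    [x^u] is in [K]; if it stays, two shifts of [u] are compared, and [u] does not escape. *)
Lemma saturation_lattice c u w w' : Npow D w -> Npow D w' -> c != 0 ->
  K ('X_[w + u] - c *: 'X_[w' + u]) -> ~ K 'X_[u] -> ~ escaping u ->
  Sat D L (mnm_diff w w').
Proof.
have [idI latS] := (cellular_ideal, Sat_lattice D L).
move=> Dw Dw' c0 /saturation_binomial[t Dt I'c] nKu nEu.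
pose A v := exists w1 w2 d, [/\ Npow D w1, Npow D w2, d != 0,
  I ('X_[w1 + v] - d *: 'X_[w2 + u]) & Sat D L (mnm_diff w2 (w1 + (t + w))%MM)].
have [[w1 [w2 [d [Dw1 Dw2 d0 Id S1]]]]|nA] := pselect (A (t + (w' + u))%MM).
  have S2 : Sat D L (mnm_diff (w1 + (t + w'))%MM w2).
    apply: contrapT => nS; apply: nEu; exists (w1 + (t + w'))%MM, w2, d; split=> //.
      by apply/NpowD; split=> //; apply/NpowD.
    by rewrite -!addmA.
  have := latticeN latS (latticeD latS S2 S1).
  by rewrite mnm_diff_trans !mnm_diffDl mnm_diffN.
case: nKu; apply: saturation_saturated (Dw) _; rewrite -mpolyXD.
apply/saturationP; exists t => //; rewrite -mpolyXD.
have At : A (t + (w + u))%MM.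
  exists 0%MM, (t + w)%MM, 1; rewrite oner_neq0 !add0m mnm_diffuu addmA.
  split=> //; [exact: Npow0|exact/NpowD|exact: ideal_congr_refl|exact: lattice0 latS].
rewrite -(restrict_congr c At nA); apply: restrict_sum I'c.
  move=> v v' e e0 Ie [w1 [w2 [d [Dw1 Dw2 d0 Id S1]]]].
  exists w1, w2, (e^-1 * d); split; rewrite ?mulf_neq0 ?invr_eq0 //.
  exact: (ideal_congr_trans idI (ideal_congrD idI w1 (ideal_congr_sym idI e0 Ie)) Id).
move=> m a b Da Db Tab [w1 [w2 [d [Dw1 Dw2 d0 Id S1]]]].
exists (w1 + a)%MM, (w2 + b)%MM, d; split=> //; try exact/NpowD.
  have := ideal_congrD idI b Id; congr (I ('X_[_] - d *: 'X_[_])).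
    by apply/mnmP => i; rewrite !mnmDE; lia.
  by apply/mnmP => i; rewrite !mnmDE; lia.
have -> : mnm_diff (w2 + b)%MM (w1 + a + (t + w))%MM =
    mnm_diff w2 (w1 + (t + w))%MM - mnm_diff a b.
  by rewrite mnm_diffN -mnm_diffD Monoid.mulmAC.
by apply: (latticeB latS) => //; apply: TS.
Qed.

Lemma component_ideal : is_ideal J.
Proof. by apply: ideal_add_ideal; [exact: saturation_ideal | exact: ideal_gen_ideal]. Qed.

Lemma saturation_sub_component : K `<=` J.
Proof. by apply: sub_ideal_addl; exact: (ideal0 (ideal_gen_ideal _)). Qed.

Lemma sub_component : I `<=` J.
Proof. by move=> f If; apply/saturation_sub_component/sub_saturation/sub_sum. Qed.

Lemma lattice_ideal_sub_component : ideal_gen (lattice_ideal D T sigma) `<=` J.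
Proof.
move=> f Tf; apply/saturation_sub_component/sub_saturation.
by apply: sub_ideal_addr Tf; exact: (ideal0 cellular_ideal).
Qed.

Lemma escaping_component u : escaping u -> J 'X_[u].
Proof.
move=> Eu; have [Iu|nIu] := pselect (I 'X_[u]); first exact: sub_component.
by apply: sub_ideal_addr; [exact: ideal0 saturation_ideal | exact: escaping_M_emb].
Qed.

(** All terms of the summand from [M_emb] are in [J]. Any other term comes from [K], where it has a
    partner; if that partner meets the summand from [M_emb], both are in [J]. *)
Lemma component_exchange : binomial_exchange J.
Proof.
move=> _ u [f Kf [g Mg <-]] uh.
have [ug|nug] := boolP (u \in msupp g).
  by left; exact: (escaping_component (M_emb_escaping Mg ug)).
have uf : u \in msupp f.
  by move/msuppD_le: uh; rewrite mem_cat (negPf nug) orbF.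
have [Ku|[v [c [vf vu c0 Kc]]]] := saturation_exchange Kf uf.
  by left; apply: saturation_sub_component.
have {}Kc := saturation_sub_component Kc.
have [vg|nvg] := boolP (v \in msupp g); last first.
  right; exists v, c; split=> //; rewrite mcoeff_msupp mcoeffD (memN_msupp_eq0 nvg).
  by rewrite addr0 -mcoeff_msupp.
left; apply: (ideal_congrX component_ideal _ (ideal_congr_sym component_ideal c0 Kc)).
  by rewrite invr_eq0.
exact: (escaping_component (M_emb_escaping Mg vg)).
Qed.

(** In [x^u = f + g], a partner of [u] in [f] must be cancelled by [g], so it escapes, and the
    congruence carries this back to [u]. *)
Lemma component_monomial u : J 'X_[u] -> K 'X_[u] \/ (I 'X_[u] \/ escaping u).
Proof.
move=> [f Kf [g Mg fgE]].
have [ug|nug] := boolP (u \in msupp g); first by right; right; exact: (M_emb_escaping Mg ug).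
have uf : u \in msupp f.
  rewrite mcoeff_msupp -[f](addrK g) fgE mcoeffB (memN_msupp_eq0 nug) subr0.
  by rewrite mcoeffX eqxx oner_neq0.
have [Ku|[v [c [vf vu c0 Kc]]]] := saturation_exchange Kf uf; first by left.
have vg : v \in msupp g.
  move: vf; rewrite -[f](addrK g) fgE => /msuppB_le.
  by rewrite mem_cat msuppX inE (negPf vu).
apply: (saturation_escaping (c := c^-1) (u := v)); rewrite ?invr_eq0 //.
  exact: (ideal_congr_sym saturation_ideal).
by right; exact: (M_emb_escaping Mg vg).
Qed.

(** Neither monomial occurs in the summand from [M_emb], so the partner of [u] in the summand from
    [K] can only be [v]; the scalar is unique modulo [J]. *)
Lemma component_binomial c u v : c != 0 -> J ('X_[u] - c *: 'X_[v]) -> ~ J 'X_[u] ->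
  K ('X_[u] - c *: 'X_[v]).
Proof.
have idJ := component_ideal; move=> c0 Jc nJu.
have nJv : ~ J 'X_[v].
  move=> Jv; apply: nJu; apply: (ideal_congrX idJ _ (ideal_congr_sym idJ c0 Jc) Jv).
  by rewrite invr_eq0.
have [uv|uv] := eqVneq u v.
  have <- : 1 = c.
    apply: (ideal_congr_uniq idJ nJv _ Jc); rewrite uv; exact: ideal_congr_refl.
  by rewrite uv; apply: ideal_congr_refl saturation_ideal _.
case: (Jc) => f Kf [g Mg fgE].
have nsupp w : ~ J 'X_[w] -> w \notin msupp g.
  by move=> nJw; apply/negP => wg; apply: nJw; exact: (escaping_component (M_emb_escaping Mg wg)).
have fE : f = 'X_[u] - c *: 'X_[v] - g by rewrite -fgE addrK.
have uf : u \in msupp f.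
  rewrite mcoeff_msupp fE !mcoeffB mcoeffZ !mcoeffX eqxx (memN_msupp_eq0 (nsupp _ nJu)).
  by rewrite (eq_sym v) (negPf uv) mulr0 !subr0 oner_neq0.
have [Ku|[w [d [wf wu d0 Kd]]]] := saturation_exchange Kf uf.
  by case: nJu; apply: saturation_sub_component.
have Jd := saturation_sub_component Kd.
move: wf; rewrite fE => /msuppB_le; rewrite mem_cat => /orP[|wg]; last first.
  case: nJu; apply: (ideal_congrX idJ _ (ideal_congr_sym idJ d0 Jd)).
    by rewrite invr_eq0.
  exact: (escaping_component (M_emb_escaping Mg wg)).
move=> /msuppB_le; rewrite mem_cat msuppX inE (negPf wu) /= => /msuppZ_le.
rewrite msuppX inE => /eqP wv; rewrite wv in Kd Jd.
by rewrite (ideal_congr_uniq idJ nJv Jc Jd).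
Qed.

Lemma component_regular h f : separated D L h -> J (h * f) -> J f.
Proof.
have [idJ satK] := (component_ideal, saturation_saturated).
have monJ w u : Npow D w -> J 'X_[w + u] -> J 'X_[u].
  move=> Dw /component_monomial[|[|]].
  - by move/(saturated_monomialM satK Dw)/saturation_sub_component.
  - by move/(saturated_monomialM cellular_saturated Dw)/sub_component.
  by move/(escapingI Dw)/escaping_component.
move=> hP; move: h hP f.
suff H h : separated D L h -> forall f, J (h * f) -> J f by [].
apply: separated_regular => //.
- exact: component_exchange.
- move=> w u v c Dw c0 Jc; have [Ju|nJu] := pselect (J 'X_[w + u]).
    apply: idealB => //; first exact: monJ Ju.
    by apply: idealZ => //; apply: (monJ w) => //; apply: (ideal_congrX idJ c0 Jc).
  have := component_binomial c0 Jc nJu.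
  by move/(saturated_binomial satK Dw)/saturation_sub_component.
move=> u w w' c Dw Dw' c0 nJu Jc.
apply: (saturation_lattice (c := c) (u := u)) => //.
- by apply: component_binomial => // Ju; apply: nJu; apply: monJ Ju.
- by move/saturation_sub_component.
by move/escaping_component.
Qed.

End Component.

End CellularBinomialIdeal.
(** * Extensions of partial characters *)

Section LatticeIndex.
Variables (n : nat) (D : {set 'I_n}) (L : set 'rV[int]_n).
Hypothesis latL : lattice D L.
Implicit Types (S T : set 'rV[int]_n) (s t : 'rV[int]_n).

(** The representatives of [lattice_index] over any finite type; adjoining a generator indexes them
    by pairs. *)
Definition coset_reps S (X : finType) (r : X -> 'rV[int]_n) : Prop :=
  (forall i, S (r i)) /\ (forall v, S v -> exists! i, L (v - r i)).

Lemma coset_reps_index S (X : finType) (r : X -> 'rV[int]_n) :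
  coset_reps S r -> lattice_index L S #|X|.
Proof.
move=> [Sr uniqr]; exists (r \o enum_val); split=> [i|v Sv]; first exact: Sr.
have [x [Lx uniqx]] := uniqr v Sv; exists (enum_rank x); split.
  by rewrite /= enum_rankK.
by move=> i /= /uniqx ->; rewrite enum_valK.
Qed.

Lemma coset_reps_inj S (X : finType) (r : X -> 'rV[int]_n) i j :
  coset_reps S r -> L (r i - r j) -> i = j.
Proof.
move=> [Sr uniqr] Lij; have [x [Lx uniqx]] := uniqr _ (Sr i).
rewrite -(uniqx i); first exact: uniqx.
by rewrite subrr; apply: (lattice0 latL).
Qed.

Lemma lattice_index_leq S (g h : nat) :
  lattice_index L S g -> lattice_index L S h -> (g <= h)%N.
Proof.
move=> [r rP] [r' [Sr' uniqr']]; have [Sr _] := rP.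
have /choice[f fP] : forall i, exists j, L (r i - r' j).
  by move=> i; have [j [Lj _]] := uniqr' _ (Sr i); exists j.
rewrite -[g]card_ord -[h]card_ord; apply: (leq_card f) => i i' fii'.
apply: (coset_reps_inj rP).
have := latticeB latL (fP i) (fP i').
by rewrite fii' opprB addrA subrK.
Qed.

Lemma lattice_index_uniq S (g h : nat) :
  lattice_index L S g -> lattice_index L S h -> g = h.
Proof. by move=> gP hP; apply/eqP; rewrite eqn_leq !(lattice_index_leq (S := S)). Qed.

Lemma coset_shift S (X : finType) (r : X -> 'rV[int]_n) s :
  lattice D S -> coset_reps S r -> S s ->
  exists f : X -> X, injective f /\ forall i, L (r i + s - r (f i)).
Proof.
move=> latS rP Ss; have [Sr uniqr] := rP.
have /choice[f fP] : forall i, exists j, L (r i + s - r j).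
  move=> i; have [j [Lj _]] := uniqr (r i + s) (latticeD latS (Sr i) Ss).
  by exists j.
exists f; split=> // i j fij; apply: (coset_reps_inj rP).
have := latticeB latL (fP i) (fP j).
by rewrite fij opprB addrA subrK opprD addrACA subrr addr0.
Qed.

(* Lagrange: translation by [s] permutes the cosets, so the sum of all
   representatives changes by an element of [L]. *)
Lemma lattice_index_multiple S (g : nat) s :
  lattice D S -> lattice_index L S g -> S s -> L (s *+ g).
Proof.
move=> latS [r rP] Ss; have [f [injf fP]] := coset_shift latS rP Ss.
have := lattice_sum latL (index_enum 'I_g) fP.
rewrite sumrB big_split /= sumr_const card_ord [X in X + _ - _](reindex_inj injf) /=.
by rewrite addrAC subrr add0r.
Qed.

Section AddGenerator.
Variables (S : set 'rV[int]_n) (s : 'rV[int]_n) (m : nat).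
Hypotheses (latS : lattice D S) (LS : L `<=` S) (m0 : (0 < m)%N) (Sm : S (s *+ m)).

(** Natural multiples of [s] suffice because [s *+ m] is in [S]. *)
Let T := [set t | exists x j, S x /\ t = x + s *+ j].

Lemma add_generator_lattice : Zpow D s -> lattice D T.
Proof.
move=> Ds; split; last first.
  move=> _ [x [j [Sx ->]]] i iD; have Dx := sub_Zpow latS Sx.
  by rewrite mxE mulmxnE Dx // Ds // mul0rn addr0.
split; first by rewrite inE; exists 0, 0%N; rewrite addr0; split=> //; exact: lattice0 latS.
move=> t t'; rewrite !inE => -[x [j [Sx ->]]] [x' [j' [Sx' ->]]].
(* Here [- j' s] is written as [j' (m - 1) s - j' m s], whose last term is in [S]. *)
exists (x - x' - s *+ m *+ j'), (j + j' * m.-1)%N; split.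
  by apply: (latticeB latS); [exact: (latticeB latS) | exact: (latticeMn latS)].
have sE : s *+ m *+ j' = s *+ (j' * m.-1) + s *+ j'.
  by rewrite -mulrnA -mulrnDr; congr (_ *+ _); nia.
rewrite sE mulrnDr; apply/rowP => i.
by move: (s *+ j) (s *+ j') (s *+ _) => a b c; rewrite !mxE; ring.
Qed.

(** Take for [h] the order of [s] modulo [S], which divides [m]; the representatives are [r i + j s]
    with [j < h]. *)
Lemma add_generator_index (g : nat) : lattice_index L S g ->
  exists2 h, lattice_index L T (g * h) & (h %| m)%N.
Proof.
move=> [r [Sr uniqr]].
have exh : exists h, (0 < h)%N && `[< S (s *+ h) >].
  by exists m; rewrite m0; apply/asboolP.
case: (ex_minnP exh) => h /andP[h0 /asboolP Sh] minh; exists h; last first.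
  rewrite /dvdn; apply: contraT; rewrite -lt0n => mh0.
  have : (h <= m %% h)%N.
    apply: minh; rewrite mh0; apply/asboolP.
    have -> : s *+ (m %% h) = s *+ m - s *+ h *+ (m %/ h).
      by rewrite {2}(divn_eq m h) mulrnDr mulnC mulrnA addrAC subrr add0r.
    by apply: (latticeB latS) => //; apply: (latticeMn latS).
  by rewrite leqNgt ltn_pmod.
have rP : coset_reps S r by [].
have small i j : (i <= j < h)%N -> S (s *+ j - s *+ i) -> i = j.
  move=> /andP[leij ltjh]; rewrite -mulrnBr // => Sij; apply/eqP.
  rewrite eqn_leq leij /= -subn_eq0; apply: contraTT ltjh; rewrite -lt0n -leqNgt => ji.
  apply: leq_trans (leq_subr i j); apply: minh; rewrite ji; exact/asboolP.
have := @coset_reps_index T ('I_g * 'I_h)%type (fun x => r x.1 + s *+ x.2).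
rewrite card_prod !card_ord; apply; split=> [[i j]|t [x [j [Sx ->]]]].
  by exists (r i), j.
pose x' := x + s *+ h *+ (j %/ h).
have Sx' : S x' by apply: (latticeD latS) => //; apply: (latticeMn latS).
have tE : x + s *+ j = x' + s *+ (j %% h).
  by rewrite /x' {1}(divn_eq j h) mulrnDr mulnC mulrnA addrA.
rewrite tE; have ltj : (j %% h < h)%N by rewrite ltn_pmod.
have [i [Li uniqi]] := uniqr x' Sx'; exists (i, Ordinal ltj); split=> /=.
  by rewrite opprD addrACA subrr addr0.
move=> [i' j'] /= Lij.
have jj' : j' = Ordinal ltj.
  apply: val_inj => /=; move: (ltn_ord j'); move: (j' : nat) Lij => {}j' Lij ltj'.
  have Sjj : S (s *+ (j %% h) - s *+ j').
    have -> : s *+ (j %% h) - s *+ j' =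
        x' + s *+ (j %% h) - (r i' + s *+ j') - (x' - r i').
      by apply/rowP => l; move: (s *+ _) (s *+ _) => a b; rewrite !mxE; ring.
    by apply: (latticeB latS); [exact: LS | exact: (latticeB latS)].
  case: (leqP j' (j %% h)) => [le|/ltnW le]; first by apply: small; rewrite ?le.
  apply/esym; apply: small; rewrite ?le // -opprB.
  exact: (latticeN latS).
rewrite jj'; congr (_, _); apply: uniqi.
by move: Lij; rewrite jj' /= opprD addrACA subrr addr0.
Qed.

End AddGenerator.

End LatticeIndex.

(** * The part of the saturation of index prime to the characteristic *)

Section PrimeToCharacteristic.
Variables (n : nat) (k : closedFieldType) (p : nat) (D : {set 'I_n}).
Variables (L S : set 'rV[int]_n).
Hypotheses (charkp : has_char k p) (latL : lattice D L) (SP : is_Sat' D p L S).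

Lemma Sat'_lattice : [/\ lattice D S, L `<=` S & S `<=` Sat D L].
Proof.
case: p SP => [->|q [[latS LS SS _] _]] //.
by split=> //; [exact: Sat_lattice | exact: sub_Sat].
Qed.

Lemma lattice_index_gt0 g : lattice_index L S g -> (0 < g)%N.
Proof.
have [latS _ _] := Sat'_lattice.
by case: g => // -[r [_ /(_ 0 (lattice0 latS))[[]]]].
Qed.

Lemma Sat'_index_neq0 g : lattice_index L S g -> g%:R != 0 :> k.
Proof.
move=> gP; have g0 := lattice_index_gt0 gP.
move: charkp SP; rewrite /has_char; case: p => [char0 _|q charq].
  have /pcharf0P -> : [pchar k] =i pred0 by [].
  by rewrite -lt0n.
move=> [[_ _ _ [h [hP coph]]] _]; rewrite (lattice_index_uniq latL gP hP).
rewrite -(dvdn_pcharf charq) -prime_coprime 1?coprime_sym //.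
by case/andP: charq.
Qed.

(** Let [N s] be in [L] and [N = m q] with [q] a power of [p] and [m] prime to [p]. Adjoining [q s]
    to [S] multiplies the index by a divisor of [m], so maximality of [S] gives [q s] in [S]. In
    characteristic 0, [q] is 1. *)
Lemma Sat'_ppower s : Sat D L s -> exists2 q, [pchar k].-nat q & S (s *+ q).
Proof.
move=> Ss; move: charkp SP; rewrite /has_char; case: p => [_ ->|p' charp].
  by exists 1%N; rewrite ?mulr1n.
have prp : prime p'.+1 by case/andP: charp.
move=> [[latS LS SS [h [hP coph]]] maxS].
have [N N0 LN] := Sat_multiple latL Ss.
have [m copm NE] := pfactor_coprime prp N0.
exists (p'.+1 ^ logn p'.+1 N)%N.
  by rewrite pnatX; apply/orP; left; rewrite pnatE.
set s1 := s *+ _.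
have m0 : (0 < m)%N by move: N0; rewrite NE; case: m {copm NE}.
have Lm : L (s1 *+ m) by rewrite /s1 -mulrnA mulnC -NE.
have Ds1 : Zpow D s1 by apply: (sub_Zpow (Sat_lattice D L)); apply: (latticeMn (Sat_lattice D L)).
have latT := add_generator_lattice latS m0 (LS _ Lm) Ds1.
have [h' h'P h'm] := add_generator_index latS LS m0 (LS _ Lm) hP.
apply: (maxS [set t | exists x j, S x /\ t = x + s1 *+ j]); last first.
  by exists 0, 1%N; rewrite add0r mulr1n; split=> //; exact: lattice0 latS.
split=> //.
- by move=> t Lt; exists t, 0%N; rewrite mulr0n addr0; split=> //; apply: LS.
- move=> _ [x [j [Sx ->]]]; apply: (latticeD (Sat_lattice D L)); first exact: SS.
  by apply: (latticeMn (Sat_lattice D L)); apply: (latticeMn (Sat_lattice D L)).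
exists (h * h')%N; split=> //; rewrite coprimeMl coph /=.
by apply: coprime_dvdl h'm _; rewrite coprime_sym.
Qed.

Section Enumeration.
Variables (g : nat) (rho : 'rV[int]_n -> k) (rho_ : 'I_g -> 'rV[int]_n -> k).
Hypotheses (gP : lattice_index L S g) (rho_ext : forall l, extends_to D L rho S (rho_ l)).
Hypothesis rho_distinct : forall l l', (forall u, S u -> rho_ l u = rho_ l' u) -> l = l'.

(** The quotient character is trivial on [L]; permuting the cosets by [s] multiplies the sum by its
    value at [s], which is not 1. *)
Lemma character_orthogonality (r : 'I_g -> 'rV[int]_n) (sigma tau : 'rV[int]_n -> k) s :
  coset_reps L S r -> partial_character D S sigma -> partial_character D S tau ->
  (forall u, L u -> sigma u = tau u) -> S s -> sigma s != tau s ->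
  \sum_i (sigma (r i))^-1 * tau (r i) = 0.
Proof.
move=> rP sigmaP tauP eqL Ss ne; have [latS LS _] := Sat'_lattice; have [Sr _] := rP.
have [f [injf fP]] := coset_shift latL latS rP Ss.
pose theta u := (sigma u)^-1 * tau u.
have thetaE i : theta (r (f i)) = theta (r i) * theta s.
  have thetaD u v : S u -> S v -> theta (u + v) = theta u * theta v.
    move=> Su Sv; rewrite /theta (characterD sigmaP) // (characterD tauP) // invfM.
    by ring.
  rewrite -thetaD //; set x := r i + s - r (f i) in fP *.
  have -> : r i + s = x + r (f i) by rewrite /x subrK.
  rewrite thetaD ?[theta x]/theta ?eqL ?mulVf ?mul1r //; first exact: (character_neq0 tauP (LS _ (fP i))).
  - exact: (fP i).
  - exact: LS (fP i).
set X := \sum_i _; have XE : X = X * theta s.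
  rewrite {1}/X (reindex_inj injf) /X mulr_suml; apply: eq_bigr => i _.
  exact: thetaE.
apply: contraTeq ne => X0; rewrite negbK; apply/eqP.
have : theta s = 1 by apply: (mulfI X0); rewrite -XE mulr1.
rewrite /theta => /(congr1 (fun x => sigma s * x)).
by rewrite mulrA divff ?mul1r ?mulr1 //; apply: (character_neq0 sigmaP).
Qed.

(* The [g] characters are pairwise orthogonal, hence span the functions on S / L;
   a further one would be orthogonal to all of them. *)
Lemma character_enumeration tau : partial_character D S tau ->
  (forall u, L u -> tau u = rho u) -> exists l, forall u, S u -> tau u = rho_ l u.
Proof.
move=> tauP tauL; apply: contrapT => ntau; case: (gP) => r rP; have [Sr _] := rP.
have extP l : partial_character D S (rho_ l) by case: (rho_ext l).
have extL l u : L u -> rho_ l u = rho u by case: (rho_ext l) => _ _; apply.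
pose A := \matrix_(l, i) (rho_ l (r i))^-1.
pose B := \matrix_(i, l) rho_ l (r i).
pose x := \col_i tau (r i).
have AB : A *m B = g%:R%:M.
  apply/matrixP => l l'; rewrite !mxE.
  under eq_bigr => i _ do rewrite !mxE.
  have [<-|ll'] := eqVneq l l'.
    under eq_bigr => i _ do rewrite mulVf ?(character_neq0 (extP l)) //.
    by rewrite sumr_const card_ord mulr1n.
  rewrite mulr0n; have [s [Ss ne]] : exists s, S s /\ rho_ l s != rho_ l' s.
    apply: contrapT => ns; move/eqP: ll'; apply; apply: rho_distinct => u Su.
    by apply: contrapT => /eqP ne; apply: ns; exists u.
  apply: (character_orthogonality rP (extP l) (extP l') _ Ss ne) => u Lu.
  by rewrite !extL.
have Ax : A *m x = 0.
  apply/colP => l; rewrite !mxE; under eq_bigr => i _ do rewrite !mxE.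
  have [s [Ss ne]] : exists s, S s /\ rho_ l s != tau s.
    apply: contrapT => ns; apply: ntau; exists l => u Su.
    by apply: contrapT => /eqP ne; apply: ns; exists u; rewrite eq_sym.
  apply: (character_orthogonality rP (extP l) tauP _ Ss ne) => u Lu.
  by rewrite extL // tauL.
have unitA : A \in unitmx.
  have : A *m B \in unitmx by rewrite AB -scalemx1 unitmxZ ?unitmx1 // unitfE Sat'_index_neq0.
  by rewrite unitmx_mul => /andP[].
have x0 : x = 0 by rewrite -(mulKmx unitA x) Ax mulmx0.
have i0 := Ordinal (lattice_index_gt0 gP).
have := character_neq0 tauP (Sr i0).
by move/colP/(_ i0): x0; rewrite !mxE => ->; rewrite eqxx.
Qed.

End Enumeration.

End PrimeToCharacteristic.
(** * Minimal primes and their components *)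

Section CharacterPrime.
Variables (n : nat) (k : closedFieldType) (D : {set 'I_n}) (L : set 'rV[int]_n).
Variable chi : 'rV[int]_n -> k.
Hypothesis chiP : partial_character D (Sat D L) chi.
Implicit Types (f g : {mpoly k[n]}) (u v w m : 'X_{1..n}).

Definition character_prime : set {mpoly k[n]} :=
  ideal_add (ideal_gen (lattice_ideal D (Sat D L) chi))
            (ideal_gen [set 'X_i | i in [set i | i \notin D]]).
Local Notation P := character_prime.

Lemma character_prime_ideal : is_ideal P.
Proof. by apply: ideal_add_ideal; apply: ideal_gen_ideal. Qed.

Lemma character_prime_sub Q : is_ideal Q ->
  (forall u v, Npow D u -> Npow D v -> Sat D L (mnm_diff u v) ->
     Q ('X_[u] - chi (mnm_diff u v) *: 'X_[v])) ->
  (forall i, i \notin D -> Q 'X_i) -> P `<=` Q.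
Proof.
move=> idQ Qbin QX; apply: ideal_add_sub => //; first exact: sub_lattice_ideal.
by apply: ideal_gen_sub => // _ [i iD <-]; apply: QX.
Qed.

Lemma character_prime_variable i : i \notin D -> P 'X_i.
Proof.
move=> iD; apply: sub_ideal_addr; first exact: ideal0 (ideal_gen_ideal _).
by apply: sub_ideal_gen; exists i.
Qed.

Lemma character_prime_monomial u : ~ Npow D u -> P 'X_[u].
Proof.
move=> /not_NpowP[i iD le].
rewrite -(submK le) mpolyXD; apply: idealMl; first exact: character_prime_ideal.
exact: character_prime_variable.
Qed.

Lemma character_prime_binomial u v : Npow D u -> Npow D v -> Sat D L (mnm_diff u v) ->
  P ('X_[u] - chi (mnm_diff u v) *: 'X_[v]).
Proof.
move=> Du Dv Suv; apply: sub_ideal_addl; first exact: ideal0 (ideal_gen_ideal _).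
by apply: sub_ideal_gen; apply: lattice_binomial_ideal.
Qed.

Lemma class_form_character_prime u f : P f -> mlin (class_form D (Sat D L) chi u) f = 0.
Proof.
move=> [g Pg [h Ph <-]]; rewrite mlinD (class_form_lattice_ideal chiP) // add0r.
move: h Ph; apply: ideal_gen_ind => [|a g' h g0 h0|m _ [i iD <-]].
- exact: mlin0.
- by rewrite mlinP g0 h0 scaler0 addr0.
rewrite -mpolyXD mlinX /class_form asboolF // => -[/NpowD[_ /(_ i iD)]].
by rewrite mnm1E eqxx.
Qed.

Lemma character_prime_Npow u : P 'X_[u] <-> ~ Npow D u.
Proof.
split=> [Pu Du|]; last exact: character_prime_monomial.
have := class_form_character_prime u Pu; rewrite mlinX (class_form_id chiP) //.
by move/eqP; rewrite oner_eq0.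
Qed.

Lemma character_prime_congr u v c : P ('X_[u] - c *: 'X_[v]) -> Npow D u ->
  [/\ Npow D v, Sat D L (mnm_diff u v) & c = chi (mnm_diff u v)].
Proof.
move=> Pc Du; apply: (class_form_congr chiP Du); exact: class_form_character_prime.
Qed.

Lemma character_prime_exchange : binomial_exchange P.
Proof.
rewrite /P ideal_gen_lattice_ideal ideal_add_gen.
apply: binomial_ideal_exchange => s [|[i iD <-]]; first exact: size_lattice_binomial.
by rewrite msuppX.
Qed.

Lemma separated_character_prime f : ~ P f -> exists2 h, separated D L h & P (f - h).
Proof.
apply: separated_representative; first exact: character_prime_ideal.
  exact: character_prime_monomial.
by move=> u v Du Dv Suv; exists (chi (mnm_diff u v)); apply: character_prime_binomial.
Qed.

(** An element outside [P] is congruent to a separated one, which is a nonzerodivisor modulo [P]. *)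
Lemma character_prime_prime : prime_ideal P.
Proof.
have idP := character_prime_ideal.
split.
  apply/idealr_closedP; split=> //; rewrite -mpolyX0 => /character_prime_Npow.
  by apply; apply: Npow0.
move=> f g; rewrite !inE => Pfg.
have [Pf|/separated_character_prime[h sh Pfh]] := pselect (P f).
  by apply/orP; left; rewrite inE.
apply/orP; right; rewrite inE; move: h sh g Pfg Pfh.
suff H h : separated D L h -> forall g, P (h * g) -> P g.
  move=> h /H regh g Pfg Pfh; apply: regh.
  by apply: (idealBl idP) Pfg; rewrite -mulrBl; apply: idealMr.
apply: separated_regular => //; first exact: character_prime_exchange.
- move=> w u Dw /character_prime_Npow nD; apply/character_prime_Npow => Du.
  by apply: nD; apply/NpowD.
- move=> w u v c Dw c0 Pc; have [Du|nDu] := pselect (Npow D u).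
    have [|/NpowD[_ Dv] Suv ->] := character_prime_congr Pc; first exact/NpowD.
    by rewrite mnm_diffDl in Suv *; apply: character_prime_binomial.
  have Pu := character_prime_monomial nDu.
  apply: idealB => //; apply: idealZ => //; apply: character_prime_monomial => Dv.
  have : P 'X_[w + v].
    by apply: (ideal_congrX idP c0 Pc); rewrite mpolyXD; apply: idealMl.
  by move=> /character_prime_Npow; apply; apply/NpowD.
move=> u w w' c Dw Dw' c0 /character_prime_Npow/contrapT Du Pc.
have [|_] := character_prime_congr Pc; first exact/NpowD.
by rewrite mnm_diffDr.
Qed.

End CharacterPrime.

(** * Primes containing a lattice ideal *)

Section PrimesOverCharacter.
Variables (n : nat) (k : closedFieldType) (D : {set 'I_n}) (L : set 'rV[int]_n).
Variable rho : 'rV[int]_n -> k.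
Hypothesis rhoP : partial_character D L rho.
Implicit Types (f g : {mpoly k[n]}) (u v w m : 'X_{1..n}) (P Q : set {mpoly k[n]}).

(** The factorization of [X^N - c] is evaluated at [f / g] in the fraction field and multiplied by
    [g^N], one factor [g] for each of the [N] roots. *)
Lemma factor_power_difference f g (c : k) (N : nat) : (0 < N)%N -> g != 0 ->
  exists zs : seq k, f ^+ N - c *: g ^+ N = \prod_(z <- zs) (f - z *: g).
Proof.
move=> N0 g0; have [zs zsE] := closed_field_poly_normal ('X^N - c%:P).
move: zsE; rewrite (monicP (monicXnsubC c N0)) scale1r => zsE.
have := size_XnsubC c N0; rewrite zsE size_prod_XsubC => -[sz].
pose t : {rmorphism {mpoly k[n]} -> {fraction {mpoly k[n]}}} := @tofrac {mpoly k[n]}.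
have inj_t : injective t by move=> x y /eqP; rewrite tofrac_eq => /eqP.
pose iota : {rmorphism k -> {fraction {mpoly k[n]}}} := t \o @mpolyC n k.
have tg : t g != 0 by rewrite tofrac_eq0.
have tZ z h : t (z *: h) = iota z * t h by rewrite -mul_mpolyC rmorphM.
have := congr1 (fun q => (map_poly iota q).[t f / t g]) zsE.
rewrite rmorphB /= map_polyXn map_polyC hornerD hornerN hornerXn hornerC.
rewrite rmorph_prod horner_prod => E.
exists zs; apply: inj_t; rewrite rmorphB rmorph_prod tZ !rmorphXn.
have -> : t f ^+ N - iota c * t g ^+ N = t g ^+ N * ((t f / t g) ^+ N - iota c).
  by rewrite expr_div_n [RHS]mulrC mulrBl divfK ?expf_neq0.
rewrite E -sz; elim: (zs) => [|z s IHs]; first by rewrite !big_nil expr0 mul1r.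
rewrite !big_cons exprS mulrACA IHs; congr (_ * _).
rewrite rmorphB /= map_polyX map_polyC hornerXsubC.
by rewrite [LHS]mulrC mulrBl divfK // rmorphB tZ.
Qed.

(** Some multiple [N (u - v)] is in [L]; the corresponding binomial of [rho] splits into factors of
    the required form. *)
Lemma prime_contains_binomial P u v : prime_ideal P ->
  lattice_ideal D L rho `<=` P -> Npow D u -> Npow D v -> Sat D L (mnm_diff u v) ->
  exists z, P ('X_[u] - z *: 'X_[v]).
Proof.
move=> prP LP Du Dv Suv.
have [N N0 LN] := Sat_multiple (character_lattice rhoP) Suv.
have Xv0 : 'X_[v] != 0 :> {mpoly k[n]} by rewrite -msupp_eq0 msuppX.
have [zs zsE] := factor_power_difference 'X_[u] (rho (mnm_diff u v *+ N)) N0 Xv0.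
have : P (\prod_(z <- zs) ('X_[u] - z *: 'X_[v])).
  rewrite -zsE !mpolyXn; apply: LP; rewrite -mnm_diffMn in LN *.
  by apply: lattice_binomial_ideal => //; apply: NpowMn.
by move/(prime_ideal_prod prP) => [z _]; exists z.
Qed.

End PrimesOverCharacter.
Lemma exprBn_pchar (R : comNzRingType) (x y : R) (q : nat) :
  [pchar R].-nat q -> (x - y) ^+ q = x ^+ q - y ^+ q.
Proof. by move=> qP; have := exprDn_pchar (x - y) y qP; rewrite subrK => ->; rewrite addrK. Qed.

Lemma partial_character_sub (n : nat) (k : closedFieldType) (D : {set 'I_n})
    (S T : set 'rV[int]_n) (chi : 'rV[int]_n -> k) :
  partial_character D T chi -> lattice D S -> S `<=` T -> partial_character D S chi.
Proof.
move=> chiP latS ST; split=> // [u /ST|u v /ST Tu /ST Tv].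
  exact: (character_neq0 chiP).
exact: (characterD chiP).
Qed.

(** * Minimal primes and components of the cellular ideal *)

Section PrimaryComponents.
Variables (n : nat) (k : closedFieldType) (p : nat) (D : {set 'I_n}) (I : set {mpoly k[n]}).
Variables (L S : set 'rV[int]_n) (rho : 'rV[int]_n -> k).
Hypotheses (charkp : has_char k p) (binI : binomial_ideal I) (cellI : cellular D I).
Hypotheses (charI : has_character D I L rho) (SP : is_Sat' D p L S).
Implicit Types (f g : {mpoly k[n]}) (u v w m : 'X_{1..n}) (P Q : set {mpoly k[n]}).

Let idI : is_ideal I := cellular_ideal cellI.
Let rhoP : partial_character D L rho := charI.1.
Let latL : lattice D L := character_lattice rhoP.

Lemma nilpotent_monomial u : ~ Npow D u -> radical I 'X_[u].
Proof.
move=> /not_NpowP[i iD le].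
rewrite -(submK le) mpolyXD; apply: idealMl; first exact: radical_ideal.
by case: cellI => _ _ /(_ i iD).
Qed.

(** Otherwise [x^v] is nilpotent modulo [I], hence so is [x^u], against saturation. *)
Lemma cellular_congr_Npow u v c : I ('X_[u] - c *: 'X_[v]) -> Npow D u -> Npow D v.
Proof.
move=> Ic Du; apply: contrapT => /nilpotent_monomial rv.
have idr := radical_ideal idI.
have [N] : radical I 'X_[u].
  by apply: (idealBr idr (sub_radical Ic)); apply: idealZ.
rewrite mpolyXn; apply: (saturated_monomial (cellular_proper cellI) (cellular_saturated cellI)).
exact: NpowMn.
Qed.

(** [P] contains a binomial [x^u - z x^v] for each [u - v] in [Sat L], and the inclusion in the
    character prime forces [z] to be the value of [chi]. *)
Lemma prime_sub_character_prime P chi : prime_ideal P -> I `<=` P ->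
  partial_character D (Sat D L) chi -> P `<=` character_prime D L chi ->
  character_prime D L chi `<=` P.
Proof.
move=> prP IP chiP Pchi; have idP : is_ideal P by case: (prP) => /idealr_closedP[].
apply: character_prime_sub => // [u v Du Dv Suv|i iD].
  have LP : lattice_ideal D L rho `<=` P.
    by move=> f lf; apply: IP; apply: (cellular_lattice_ideal charI).
  have [z Pz] := prime_contains_binomial rhoP prP LP Du Dv Suv.
  by have [_ _ <-] := character_prime_congr chiP (Pchi _ Pz) Du.
have [_ _ /(_ i iD)[N IN]] := cellI.
by apply: (prime_idealX prP (N := N)); apply: IP.
Qed.

Section Component.
Variables (rho' chi : 'rV[int]_n -> k).
Hypotheses (rho'P : extends_to D L rho S rho') (chiP : extends_to D S rho' (Sat D L) chi).
Local Notation P := (character_prime D L chi).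
Local Notation J := (ideal_add (colon_infty (ideal_add I (ideal_gen (lattice_ideal D S rho')))
  (\prod_(i in D) 'X_i)) (M_emb D I)).

Let char_chi : partial_character D (Sat D L) chi. Proof. by case: chiP. Qed.
Let char_rho' : partial_character D S rho'. Proof. by case: rho'P. Qed.
Let prP : prime_ideal P := character_prime_prime char_chi.
Let idP : is_ideal P := character_prime_ideal D L chi.
Let S_Sat : S `<=` Sat D L. Proof. by case: chiP. Qed.

(** The monomials of a binomial of [I] are both over N^D or both not. In the first case it belongs
    to the lattice ideal of [rho], which [chi] extends. *)
Lemma sub_character_prime : I `<=` P.
Proof.
case: binI => B [B2 IE]; rewrite IE; apply: ideal_gen_sub => // b Bb.
have Ib : I b by rewrite IE; apply: sub_ideal_gen.
case: (binomialP (B2 _ Bb)) => [->|[a [v [a0 bE]]]|[a [c [v [w [a0 c0 vw bE]]]]]].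
- exact: ideal0.
- rewrite bE; apply: idealZ => //; apply: character_prime_monomial => Dv.
  apply: (saturated_monomial (cellular_proper cellI) (cellular_saturated cellI) Dv).
  by apply: (idealZK idI a0); rewrite -bE.
have Ic : I ('X_[v] - c *: 'X_[w]) by apply: (idealZK idI a0); rewrite -bE.
rewrite bE; apply: idealZ => //.
have [Dv|nDv] := pselect (Npow D v); last first.
  apply: idealB => //; first exact: character_prime_monomial.
  apply: idealZ => //; apply: character_prime_monomial => Dw; apply: nDv.
  exact: (cellular_congr_Npow (ideal_congr_sym idI c0 Ic) Dw).
have Dw := cellular_congr_Npow Ic Dv.
have : lattice_ideal D L rho ('X_[v] - c *: 'X_[w]).
  case: charI => _ <-; split=> // m /msuppB_le.
  rewrite mem_cat msuppX inE => /orP[/eqP ->//|/msuppZ_le].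
  by rewrite msuppX inE => /eqP ->.
move/sub_ideal_gen; apply: sub_lattice_ideal => // x y Dx Dy Lxy.
have [_ LS rhoE] := rho'P; have [_ _ chiE] := chiP.
rewrite -rhoE // -chiE; last exact: LS.
by apply: character_prime_binomial => //; apply/S_Sat/LS.
Qed.

Lemma character_prime_minimal P' : prime_ideal P' -> I `<=` P' -> P' `<=` P -> P' = P.
Proof.
move=> prP' IP' P'P; apply/seteqP; split=> //.
exact: prime_sub_character_prime.
Qed.

(** By additivity of Frobenius, a [q]-th power of a binomial of [chi] is a binomial of [rho'] once
    [q (u - v)] is in [S]. *)
Lemma character_prime_radical : P `<=` radical J.
Proof.
have idJ : is_ideal J by exact: component_ideal.
apply: character_prime_sub => [|u v Du Dv Suv|i iD]; first exact: radical_ideal.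
  have [q qp Sq] := Sat'_ppower charkp latL SP Suv.
  exists q; rewrite exprBn_pchar; last first.
    apply: sub_in_pnat qp => x _; exact: (rmorph_pchar (@mpolyC n k)).
  rewrite exprZn !mpolyXn -(characterMn char_chi) //.
  apply: lattice_ideal_sub_component => //; apply: sub_ideal_gen.
  have [_ _ /(_ _ Sq) ->] := chiP; rewrite -mnm_diffMn in Sq *.
  by apply: lattice_binomial_ideal => //; apply: NpowMn.
have [_ _ /(_ i iD)[N IN]] := cellI.
by exists N; apply: sub_component.
Qed.

(** Write [s = h + b] with [h] separated and [b] in the radical of [J]. Since [s] divides
    [h^N - (-b)^N], the product [h^N f] is in [J] for large [N], and [h] can be cancelled. *)
Lemma local_kernel_sub_component : local_kernel I P `<=` J.
Proof.
have idJ : is_ideal J by exact: component_ideal.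
move=> f [s [Ps Isf]]; have Jsf : J (s * f) by apply: sub_component.
have [h sh /character_prime_radical[N Jb]] := separated_character_prime Ps.
have : J (h ^+ N * f).
  set b := s - h in Jb; have -> : h ^+ N * f = (h ^+ N - (- b) ^+ N) * f + (- b) ^+ N * f.
    by rewrite mulrBl subrK.
  apply: idealD => //.
    have -> : h ^+ N - (- b) ^+ N = s * (\sum_(i < N) h ^+ (N.-1 - i) * (- b) ^+ i).
      by rewrite subrXX opprK [h + b]addrC /b subrK.
    by rewrite mulrAC; apply: idealMr.
  by rewrite exprNn; apply: idealMr => //; apply: idealMl.
elim: N {Jb} => [|N IHN]; first by rewrite expr0 mul1r.
rewrite exprS -mulrA => Jh; apply: IHN; move: Jh.
exact: (component_regular binI cellI charI char_rho' S_Sat sh).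
Qed.

Variable g : nat.
Hypothesis gP : lattice_index L S g.

(* With [a = x^u] and [b = rho'(u - v) x^v], the cofactor of [a - b] in
   [a^g - b^g], a member of [I], is [g b^(g-1)] modulo [P]. *)
Lemma lattice_binomial_local_kernel u v : Npow D u -> Npow D v -> S (mnm_diff u v) ->
  local_kernel I P ('X_[u] - rho' (mnm_diff u v) *: 'X_[v]).
Proof.
have [latS _ _] := Sat'_lattice latL SP; move=> Du Dv Suv.
set z := rho' _; pose a : {mpoly k[n]} := 'X_[u]; pose b := z *: 'X_[v] : {mpoly k[n]}.
have zE : z = chi (mnm_diff u v) by case: chiP => _ _ ->.
have z0 : z != 0 by apply: (character_neq0 char_rho').
have Pab : P (a - b) by rewrite /b zE; apply: character_prime_binomial => //; apply: S_Sat.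
exists (\sum_(i < g) a ^+ (g.-1 - i) * b ^+ i); split=> [Ps|]; last first.
  have Lg := lattice_index_multiple latL latS gP Suv.
  have -> : (\sum_(i < g) a ^+ (g.-1 - i) * b ^+ i) * ('X_[u] - z *: 'X_[v]) = a ^+ g - b ^+ g.
    by rewrite subrXX mulrC.
  rewrite /a /b exprZn !mpolyXn /z -(characterMn char_rho') //.
  have [_ _ ->] := rho'P; last exact: Lg.
  apply: (cellular_lattice_ideal charI); rewrite -mnm_diffMn in Lg *.
  by apply: lattice_binomial_ideal => //; apply: NpowMn.
(* Modulo [a - b], every summand of the cofactor becomes [b^(g-1)]. *)
have Pg : P (\sum_(i < g) b ^+ g.-1).
  apply: (idealBl idP) Ps; rewrite -sumrB; apply: ideal_sum => // i _.
  have -> : b ^+ g.-1 = b ^+ (g.-1 - i) * b ^+ i.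
    by rewrite -exprD subnK //; have := ltn_ord i; lia.
  by rewrite -mulrBl subrXX -mulrA; apply: idealMr.
move: Pg; rewrite sumr_const card_ord exprZn mpolyXn -scaler_nat scalerA.
move/(idealZK idP); rewrite mulf_neq0 ?expf_neq0 ?(Sat'_index_neq0 charkp latL SP gP) //.
by move=> /(_ isT)/(character_prime_Npow char_chi); apply; apply: NpowMn.
Qed.

Lemma component_sub_local_kernel : J `<=` local_kernel I P.
Proof.
have idK : is_ideal (local_kernel I P) by apply: local_kernel_ideal.
apply: ideal_add_sub => //.
  move=> f /(saturationP cellI)[w Dw]; set I' := ideal_add _ _ => I'f.
  have sub : I' `<=` local_kernel I P.
    apply: ideal_add_sub => //; first exact: sub_local_kernel.
    by apply: sub_lattice_ideal => //; apply: lattice_binomial_local_kernel.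
  apply: (local_kernelM prP _ (sub _ I'f)).
  by move=> /(character_prime_Npow char_chi).
move=> f Mf; rewrite (mpolyE f) big_seq; apply: ideal_sum => // m mf.
apply: idealZ => //.
have [w [w' [c [Dw Dw' c0 Ic nS]]]] := M_emb_escaping cellI charI Mf mf.
(* This multiplier is outside [P] because [w - w'] is not in [Sat L]. *)
exists ('X_[w] - c *: 'X_[w']); rewrite mulrBl -scalerAl -!mpolyXD; split=> //.
by move=> /(character_prime_congr char_chi)/(_ Dw)[].
Qed.

Lemma component_local_kernel : J = local_kernel I P.
Proof.
by apply/seteqP; split; [exact: component_sub_local_kernel | exact: local_kernel_sub_component].
Qed.

End Component.

Section Enumeration.
Variables (g : nat) (rho_ chi : 'I_g -> 'rV[int]_n -> k).
Hypotheses (gP : lattice_index L S g).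
Hypothesis rho_ext : forall l, extends_to D L rho S (rho_ l).
Hypothesis rho_distinct : forall l l', (forall s, S s -> rho_ l s = rho_ l' s) -> l = l'.
Hypothesis chi_ext : forall l, extends_to D S (rho_ l) (Sat D L) (chi l).

(** The binomials of [P] define a character whose lattice contains [Sat L] and which restricts to
    [rho] on [L]; on [S] it is one of the [rho_ l]. *)
Lemma character_prime_below P : prime_ideal P -> I `<=` P -> saturated D P ->
  exists l, character_prime D L (chi l) `<=` P.
Proof.
move=> prP IP satP; have [idP P1] : is_ideal P /\ ~ P 1 by case: (prP) => /idealr_closedP.
have [latS LS SS] := Sat'_lattice latL SP.
have LP : lattice_ideal D L rho `<=` P.
  by move=> f lf; apply: IP; apply: (cellular_lattice_ideal charI).
have [tau [tauP ratioP]] := saturated_character idP P1 satP.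
have SatP : Sat D L `<=` ideal_lattice D P.
  move=> s Ss; have [u [v [Du Dv sE]]] := Zpow_mnm_diff (sub_Zpow (Sat_lattice D L) Ss).
  rewrite sE in Ss *.
  have [z Pz] := prime_contains_binomial rhoP prP LP Du Dv Ss.
  by exists z, u, v.
have tauL s : L s -> tau s = rho s.
  move=> Ls; apply: (ideal_ratio_uniq idP P1 satP (s := s)).
    by apply: ratioP; apply/SatP/SS/LS.
  have [u [v [Du Dv sE]]] := Zpow_mnm_diff (sub_Zpow latL Ls).
  exists u, v; split=> //; apply: LP; rewrite sE in Ls *.
  exact: lattice_binomial_ideal.
have tauS : partial_character D S tau.
  by apply: partial_character_sub tauP latS _; apply: subset_trans SS SatP.
have [l tauE] := character_enumeration charkp latL SP gP rho_ext rho_distinct tauS tauL.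
exists l; have [chiP _ chiE] := chi_ext l.
(* The two values have equal [q]-th powers, with [q s] in [S], and Frobenius is injective on a
   field. *)
have tau_chi s : Sat D L s -> tau s = chi l s.
  move=> Ss; have [q qp Sq] := Sat'_ppower charkp latL SP Ss.
  have : tau s ^+ q = chi l s ^+ q.
    rewrite -(characterMn tauP) -?(characterMn chiP) //; last exact: SatP.
    by rewrite tauE // chiE.
  move/eqP; rewrite -subr_eq0 -exprBn_pchar // expf_eq0 subr_eq0.
  by case/andP => _ /eqP.
apply: character_prime_sub => // [u v Du Dv Suv|i iD].
  rewrite -tau_chi //; apply: ideal_ratio_binomial (ratioP _ (SatP _ Suv)) => //.
have [_ _ /(_ i iD)[N IN]] := cellI.
by apply: (prime_idealX prP (N := N)); apply: IP.
Qed.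

Lemma character_prime_associated l : associated_prime I (character_prime D L (chi l)).
Proof.
have [chiP _ _] := chi_ext l.
apply: minimal_prime_associated => //.
- exact: mpoly_noetherian.
- exact: character_prime_prime.
- exact: (sub_character_prime (rho_ext l) (chi_ext l)).
move=> P' [prP' [f PE]]; apply: (character_prime_minimal (chi_ext l) prP').
by rewrite PE; apply: sub_colon.
Qed.

Lemma minimal_associated_primeP P :
  minimal_associated_prime I P <-> exists l, P = character_prime D L (chi l).
Proof.
split=> [[[prP [f PE]] minP]|[l ->]]; last first.
  split=> [|P' [prP' [f PE]]]; first exact: character_prime_associated.
  apply: (character_prime_minimal (chi_ext l) prP').
  by rewrite PE; apply: sub_colon.
(* An associated prime [I : f] inherits saturation from [I], so it contains one of the character
   primes. *)
have [l lP] : exists l, character_prime D L (chi l) `<=` P.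
  apply: character_prime_below => //; first by rewrite PE; apply: sub_colon.
  rewrite PE => w h Dw; rewrite /colon /= -mulrA.
  exact: (cellular_saturated cellI Dw).
exists l; apply/esym/minP => //; exact: character_prime_associated.
Qed.

End Enumeration.

End PrimaryComponents.
Theorem theorem4p3 (n : nat) (k : closedFieldType) (p : nat)
    (charkp : has_char k p) (Delta : {set 'I_n}) (I : set {mpoly k[n]})
    (binI : binomial_ideal I) (cellI : cellular Delta I)
    (L : set 'rV[int]_n) (rho : 'rV[int]_n -> k)
    (charI : has_character Delta I L rho)
    (S' : set 'rV[int]_n) (S'P : is_Sat' Delta p L S')
    (g : nat) (gP : lattice_index L S' g)
    (rho_ : 'I_g -> 'rV[int]_n -> k)
    (rho_ext : forall l, extends_to Delta L rho S' (rho_ l))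
    (rho_distinct : forall l l', (forall u, S' u -> rho_ l u = rho_ l' u) ->
       l = l')
    (chi : 'I_g -> 'rV[int]_n -> k)
    (chi_ext : forall l, extends_to Delta S' (rho_ l) (Sat Delta L) (chi l)) :
  let P (l : 'I_g) : set {mpoly k[n]} :=
    ideal_add (ideal_gen (lattice_ideal Delta (Sat Delta L) (chi l)))
              (ideal_gen [set 'X_i | i in [set i | i \notin Delta]]) in
  (forall J : set {mpoly k[n]},
     minimal_associated_prime I J <-> exists l, J = P l) /\
  (forall l : 'I_g,
     is_primary_component I (P l)
       (ideal_add
          (colon_infty
             (ideal_add I (ideal_gen (lattice_ideal Delta S' (rho_ l))))
             (\prod_(i in Delta) 'X_i))
          (M_emb Delta I))).
Proof.
move=> P; have idI := cellular_ideal cellI.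
split=> [J|l].
  exact: (minimal_associated_primeP charkp binI cellI charI S'P gP rho_ext
    rho_distinct chi_ext).
split.
  apply: minimal_primary_decomposition_exists => //; first exact: mpoly_noetherian.
  exact: cellular_proper cellI.
move=> r Q minQ.
(* The local kernel does not refer to [Q], so it is the component in every minimal decomposition. *)
rewrite (component_local_kernel charkp binI cellI charI S'P (rho_ext l) (chi_ext l) gP).
have [chiP _ _] := chi_ext l.
apply: (minimal_component (character_prime_prime chiP) _ _ minQ).
  exact: (sub_character_prime binI cellI charI (rho_ext l) (chi_ext l)).
move=> P' prP' IP' P'P.
exact: (character_prime_minimal cellI charI (chi_ext l) prP').
Qed.
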